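(* Let $f(z)=z+a_2z^2+a_3z^3+\cdots\in\mathcal{S}^*_G$, and let $$\gamma_1=\tfrac12 a_2,\qquad \gamma_2=\tfrac12\left(a_3-\tfrac12a_2^2\right),\qquad \gamma_3=\tfrac12\left(a_4-a_2a_3+\tfrac13a_2^3\right).$$ Then $$|H_{2,1}(F_f/2)|:=|\gamma_1\gamma_3-\gamma_2^2|\le \frac1{64}.$$ The inequality is sharp, i.e. there exists $f\in\mathcal{S}^*_G$ for which equality holds.
   Context: Let $\mathbb{D}=\{z\in\mathbb{C}:|z|<1\}$ and let $\mathcal{A}$ be the class of holomorphic functions $f$ on $\mathbb{D}$ with $f(0)=0$, $f'(0)=1$, i.e. $f(z)=z+\sum_{n\ge2}a_nz^n$. For analytic $g,h$ on $\mathbb{D}$, $g\prec h$ ($g$ is subordinate to $h$) means that there is an analytic $\omega:\mathbb{D}\to\mathbb{C}$ with $\omega(0)=0$ and $|\omega(z)|<1$ on $\mathbb{D}$ such that $g(z)=h(\omega(z))$ for all $z\in\mathbb{D}$. Let $\Psi(z)=\dfrac{z}{\ln(1+z)}$ for $z\in\mathbb{D}$ (principal branch of the logarithm, $\Psi(0)=1$); its Taylor coefficients at $0$ are the Gregory coefficients, $\Psi(z)=1+\frac12z-\frac1{12}z^2+\frac1{24}z^3-\cdots$. Define $$\mathcal{S}^*_G=\left\{f\in\mathcal{A}:\ \frac{zf'(z)}{f(z)}\prec\Psi(z)\right\},$$ where $zf'(z)/f(z)$ is understood to take the value $1$ at $z=0$. The numbers $\gamma_n$ are the logarithmic coefficients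 of $f$, defined by $F_f(z)=\log\frac{f(z)}{z}=2\sum_{n\ge1}\gamma_nz^n$ with $\log1=0$. *)

(* Defs.v *)
From Stdlib Require Import Reals.
From Coquelicot Require Export Coquelicot.

Open Scope R_scope.
Open Scope C_scope.

Definition unit_disk (z : C) : Prop := (Cmod z < 1)%R.

(* Functions on the disk are total functions C -> C; only their values on the
   disk matter. *)
Definition holomorphic_on_disk (f : C -> C) : Prop :=
  forall z : C, unit_disk z -> ex_derive (K := C_AbsRing) (V := C_NormedModule) f z.

Definition class_A (f : C -> C) : Prop :=
  holomorphic_on_disk f /\ f 0 = 0 /\ C_derive f 0 = 1.

Definition taylor_expansion (f : C -> C) (a : nat -> C) : Prop :=
  forall z : C, unit_disk z -> is_pseries (K := C_AbsRing) (V := C_NormedModule) a z (f z).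

Definition subordinate (g h : C -> C) : Prop :=
  exists w : C -> C,
    holomorphic_on_disk w /\ w 0 = 0 /\
    (forall z : C, unit_disk z -> (Cmod (w z) < 1)%R) /\
    (forall z : C, unit_disk z -> g z = h (w z)).

(* Principal argument, with values in (-PI, PI] for z <> 0. *)
Definition Carg (z : C) : R :=
  if Rle_dec 0 (Im z) then acos (Re z / Cmod z) else (- acos (Re z / Cmod z))%R.

Definition Clog (z : C) : C := (ln (Cmod z), Carg z).

Definition Psi (z : C) : C := if Ceq_dec z 0 then 1 else z / Clog (1 + z).

(* z f'(z) / f(z), extended by its limit 1 at the origin. *)
Definition starlike_quotient (f : C -> C) (z : C) : C :=
  if Ceq_dec z 0 then 1 else z * C_derive f z / f z.

(* The nonvanishing clause says that the quotient is defined on the punctured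
   disk, since Coquelicot's division is total. *)
Definition class_SG (f : C -> C) : Prop :=
  class_A f /\
  (forall z : C, unit_disk z -> z <> 0 -> f z <> 0) /\
  subordinate (starlike_quotient f) Psi.

(* Logarithmic coefficients of f(z) = z + a_2 z^2 + a_3 z^3 + ...,
   where log (f(z)/z) = 2 (gamma_1 z + gamma_2 z^2 + ...). *)
Definition gamma1 (a : nat -> C) : C := / 2 * a 2%nat.
Definition gamma2 (a : nat -> C) : C := / 2 * (a 3%nat - / 2 * a 2%nat ^ 2).
Definition gamma3 (a : nat -> C) : C :=
  / 2 * (a 4%nat - a 2%nat * a 3%nat + / 3 * a 2%nat ^ 3).

Definition hankel21 (a : nat -> C) : C := gamma1 a * gamma3 a - gamma2 a ^ 2.

(* Main.v *)
(** Upper bound. Write [z f'/f = Psi o w] with a Schwarz function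
    [w = c1 z + c2 z^2 + c3 z^3 + ...]; then
      [2304 (gamma1 gamma3 - gamma2^2) = 48 c1 c3 - 4 c1^2 c2 - 36 c2^2 + 3 c1^4].
    Since [|w| <= 1], multiplication by [w] contracts the L^2 norm on circles, so the
    truncated Toeplitz matrix of [c] is a contraction. This gives
      [c2 = A x],  [c3 = A (- conj c1 x^2 + (1 - |x|^2) y)],  [A = 1 - |c1|^2],
    with [|x|, |y| <= 1], and the triangle inequality bounds the functional by
    [36 - 20 |c1|^2 - 13 |c1|^4].

    As [w] is only assumed complex differentiable, its coefficients are obtained from
    Goursat's theorem: by periodicity, the integral of
    [w (exp zeta) exp (- n zeta)] over [[0, 2 pi]] does not depend on [Re zeta], and its
    value is read off the 3-jet of [w] at 0 when [Re zeta] tends to minus infinity.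
    That jet comes from the Taylor series of [f] by inverting [log (1 + w) / w].

    Sharpness. Take [w = z^2]. The reciprocal power series of [log (1 + z) / z] has
    coefficients bounded by 1 (Kaluza), so [z u' = (Psi (z^2) - 1) u] is solved by a power
    series [u] with bounded coefficients, which has no zero, and [f = z u]. *)

Require Import Defs.
From Stdlib Require Import Reals Lra Lia Psatz FunctionalExtensionality.
From Coquelicot Require Import Coquelicot.
Local Open Scope R_scope.
Bind Scope C_scope with C.
Arguments Cmod x%_C_scope.
Arguments Cconj x%_C_scope.

(** * Complex derivatives *)

(** The constant is the bound at c1 = 0, as 36 / 2304 = 1 / 64. Equality there requires c1 = 0 and
    |c2| = 1, which forces w to be a rotation of z^2; hence the choice of w for sharpness.

    Bounding |c2| and |c3| separately by 1 - |c1|^2 is too weak: at |c1| = 1/2 the triangle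
    inequality then gives more than 39. The term 48 c1 c3 and the term 36 c2^2 cannot be large
    together, and the Toeplitz contraction is what records this joint constraint.

    Only c1, c2, c3 enter, so everything at the origin is done modulo O(z^4) and no power series of
    w is ever produced. The change of variable z = exp zeta turns annuli into rectangles, so that
    Goursat on rectangles suffices, and it sends the origin to infinity, where the O(z^4) remainder
    is strong enough to beat z^(-n) for n <= 3. *)

Definition Cder (f : C -> C) (z l : C) : Prop :=
  forall eps : R, 0 < eps -> exists delta : R, 0 < delta /\
    forall h : C, Cmod h < delta -> Cmod (f (z + h)%C - f z - h * l) <= eps * Cmod h.

Lemma Cder_is_derive (f : C -> C) (z l : C) :
  Cder f z l -> is_derive (K := C_AbsRing) (V := C_NormedModule) f z l.
Proof.
  intros H; split.
  - apply is_linear_scal_l.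
  - intros x Hx eps.
    apply (is_filter_lim_locally_unique (V := AbsRing_NormedModule C_AbsRing)) in Hx; subst x.
    destruct (H eps (cond_pos eps)) as (d & Hd & Hf).
    exists (mkposreal d Hd); intros y Hy.
    specialize (Hf (y - z)%C Hy).
    assert (E : forall a b : C, (a + (b - a))%C = b) by (intros; ring).
    rewrite E in Hf.
    exact Hf.
Qed.

Lemma is_derive_Cder (f : C -> C) (z l : C) :
  is_derive (K := C_AbsRing) (V := C_NormedModule) f z l -> Cder f z l.
Proof.
  intros [_ H] eps Heps.
  destruct (H z (fun P HP => HP) (mkposreal eps Heps)) as [d Hd].
  exists d; split; [apply cond_pos |].
  intros h Hh.
  assert (E : (z + h - z)%C = h) by ring.
  assert (B : ball (M := AbsRing_UniformSpace C_AbsRing) z d (z + h)%C).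
  { change (Cmod (z + h - z) < d). now rewrite E. }
  specialize (Hd _ B).
  change (Cmod (f (z + h)%C - f z - (z + h - z) * l) <= eps * Cmod (z + h - z)) in Hd.
  now rewrite E in Hd.
Qed.

Lemma Cder_C_derive (f : C -> C) (z l : C) : Cder f z l -> C_derive f z = l.
Proof. intros H; now apply is_C_derive_unique, Cder_is_derive. Qed.

Lemma ex_derive_Cder (f : C -> C) (z : C) :
  ex_derive (K := C_AbsRing) (V := C_NormedModule) f z -> Cder f z (C_derive f z).
Proof.
  intros [l Hl]. apply is_derive_Cder in Hl. now rewrite (Cder_C_derive _ _ _ Hl).
Qed.

Lemma Cder_ext_loc (f g : C -> C) (z l : C) (d : R) :
  0 < d -> (forall h, Cmod h < d -> f (z + h)%C = g (z + h)%C) -> Cder f z l -> Cder g z l.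
Proof.
  intros Hd E H eps He. destruct (H eps He) as (d' & Hd' & H').
  exists (Rmin d d'); split; [now apply Rmin_glb_lt |].
  intros h Hh.
  assert (E0 : f z = g z).
  { replace z with (z + 0)%C by ring. apply E. now rewrite Cmod_0. }
  rewrite <- E0, <- E by (eapply Rlt_le_trans; [exact Hh | apply Rmin_l]).
  apply H'. eapply Rlt_le_trans; [exact Hh | apply Rmin_r].
Qed.

Lemma Cder_id (z : C) : Cder (fun z => z) z 1.
Proof.
  intros eps He; exists 1; split; [lra |]; intros h _.
  replace (z + h - z - h * 1)%C with (RtoC 0) by ring.
  rewrite Cmod_0. assert (0 <= Cmod h) by apply Cmod_ge_0. nra.
Qed.

Lemma Cder_const (c z : C) : Cder (fun _ => c) z 0.
Proof.
  intros eps He; exists 1; split; [lra |]; intros h _.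
  replace (c - c - h * 0)%C with (RtoC 0) by ring.
  rewrite Cmod_0. assert (0 <= Cmod h) by apply Cmod_ge_0. nra.
Qed.

Lemma Cder_lipschitz (f : C -> C) (z l : C) : Cder f z l ->
  exists delta : R, 0 < delta /\
    forall h, Cmod h < delta -> Cmod (f (z + h)%C - f z) <= (Cmod l + 1) * Cmod h.
Proof.
  intros H. destruct (H 1 Rlt_0_1) as (d & Hd & Hf).
  exists d; split; [exact Hd |]. intros h Hh. specialize (Hf h Hh).
  replace (f (z + h)%C - f z)%C with ((f (z + h)%C - f z - h * l) + h * l)%C by ring.
  eapply Rle_trans; [apply Cmod_triangle |]. rewrite Cmod_mult. lra.
Qed.

Lemma Cder_plus (f g : C -> C) (z l m : C) :
  Cder f z l -> Cder g z m -> Cder (fun z => f z + g z)%C z (l + m).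
Proof.
  intros Hf Hg eps He.
  destruct (Hf (eps / 2)) as (d & Hd & Hf'); [lra |].
  destruct (Hg (eps / 2)) as (d' & Hd' & Hg'); [lra |].
  exists (Rmin d d'); split; [now apply Rmin_glb_lt |].
  intros h Hh.
  assert (h1 := Hf' h (Rlt_le_trans _ _ _ Hh (Rmin_l _ _))).
  assert (h2 := Hg' h (Rlt_le_trans _ _ _ Hh (Rmin_r _ _))).
  replace (f (z + h)%C + g (z + h)%C - (f z + g z) - h * (l + m))%C
    with ((f (z + h)%C - f z - h * l) + (g (z + h)%C - g z - h * m))%C by ring.
  eapply Rle_trans; [apply Cmod_triangle |]. lra.
Qed.

Lemma Cder_comp (f g : C -> C) (z l m : C) :
  Cder g z m -> Cder f (g z) l -> Cder (fun z => f (g z)) z (m * l).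
Proof.
  intros Hg Hf eps He.
  destruct (Cder_lipschitz _ _ _ Hg) as (d1 & Hd1 & Lg).
  assert (Kp : 0 < Cmod m + 1) by (pose proof (Cmod_ge_0 m); lra).
  assert (Lp : 0 < Cmod l + 1) by (pose proof (Cmod_ge_0 l); lra).
  destruct (Hf (eps / 2 / (Cmod m + 1))) as (d2 & Hd2 & Hf').
  { apply Rdiv_lt_0_compat; lra. }
  destruct (Hg (eps / 2 / (Cmod l + 1))) as (d3 & Hd3 & Hg').
  { apply Rdiv_lt_0_compat; lra. }
  exists (Rmin (Rmin d1 d3) (d2 / (Cmod m + 1))); split.
  { repeat apply Rmin_glb_lt; auto. now apply Rdiv_lt_0_compat. }
  intros h Hh.
  assert (hd1 : Cmod h < d1) by (eapply Rlt_le_trans; [exact Hh |]; eapply Rle_trans; apply Rmin_l).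
  assert (hd3 : Cmod h < d3).
  { eapply Rlt_le_trans; [exact Hh |]; eapply Rle_trans; [apply Rmin_l | apply Rmin_r]. }
  assert (hd2 : Cmod h < d2 / (Cmod m + 1)) by (eapply Rlt_le_trans; [exact Hh | apply Rmin_r]).
  specialize (Lg h hd1). specialize (Hg' h hd3).
  set (k := (g (z + h)%C - g z)%C) in *.
  assert (Hk : Cmod k < d2).
  { eapply Rle_lt_trans; [exact Lg |].
    apply (Rmult_lt_compat_l (Cmod m + 1)) in hd2; [| exact Kp].
    replace ((Cmod m + 1) * (d2 / (Cmod m + 1))) with d2 in hd2 by (field; lra). exact hd2. }
  specialize (Hf' k Hk).
  replace (g z + k)%C with (g (z + h)%C) in Hf' by (unfold k; ring).
  replace (f (g (z + h)%C) - f (g z) - h * (m * l))%C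
    with ((f (g (z + h)%C) - f (g z) - k * l) + (k - h * m) * l)%C by ring.
  eapply Rle_trans; [apply Cmod_triangle |]. rewrite Cmod_mult.
  assert (Hl := Cmod_ge_0 l). assert (Hh0 := Cmod_ge_0 h).
  assert (B1 : eps / 2 / (Cmod m + 1) * Cmod k <= eps / 2 * Cmod h).
  { replace (eps / 2 * Cmod h) with (eps / 2 / (Cmod m + 1) * ((Cmod m + 1) * Cmod h)) by (field; lra).
    apply Rmult_le_compat_l; [apply Rlt_le, Rdiv_lt_0_compat; lra | exact Lg]. }
  assert (B2 : Cmod (k - h * m) * Cmod l <= eps / 2 * Cmod h).
  { apply Rle_trans with (eps / 2 / (Cmod l + 1) * Cmod h * (Cmod l + 1)).
    - apply Rmult_le_compat; try apply Cmod_ge_0; [exact Hg' | lra].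
    - apply Req_le; field; lra. }
  lra.
Qed.

Lemma Cder_mult (f g : C -> C) (z l m : C) :
  Cder f z l -> Cder g z m -> Cder (fun z => f z * g z)%C z (l * g z + f z * m).
Proof.
  intros Hf Hg eps He.
  destruct (Cder_lipschitz _ _ _ Hg) as (d1 & Hd1 & Lg).
  assert (Hl := Cmod_ge_0 l). assert (Hm := Cmod_ge_0 m).
  set (A := Cmod (g z) + 1 + (Cmod m + 1)).
  assert (HA : 0 < A) by (unfold A; pose proof (Cmod_ge_0 (g z)); lra).
  set (B := Cmod (f z) + 1).
  assert (HB : 0 < B) by (unfold B; pose proof (Cmod_ge_0 (f z)); lra).
  set (D := Cmod l * (Cmod m + 1) + 1).
  assert (HD : 0 < D) by (unfold D; nra).
  destruct (Hf (eps / 3 / A)) as (d2 & Hd2 & Hf'); [apply Rdiv_lt_0_compat; lra |].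
  destruct (Hg (eps / 3 / B)) as (d3 & Hd3 & Hg'); [apply Rdiv_lt_0_compat; lra |].
  assert (H3 : 0 < eps / 3 / D) by (apply Rdiv_lt_0_compat; lra).
  exists (Rmin (Rmin d1 d2) (Rmin d3 (Rmin (eps / 3 / D) 1))); split.
  { repeat apply Rmin_glb_lt; auto; lra. }
  intros h Hh.
  apply Rmin_Rgt_l in Hh as [Hh1 Hh2].
  apply Rmin_Rgt_l in Hh1 as [Hh1 Hh1'].
  apply Rmin_Rgt_l in Hh2 as [Hh2 Hh3].
  apply Rmin_Rgt_l in Hh3 as [Hh3 Hh4].
  specialize (Lg h Hh1). specialize (Hf' h Hh1'). specialize (Hg' h Hh2).
  assert (Hh0 := Cmod_ge_0 h).
  replace (f (z + h)%C * g (z + h)%C - f z * g z - h * (l * g z + f z * m))%C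
    with ((f (z + h)%C - f z - h * l) * (g z + (g (z + h)%C - g z))
          + f z * (g (z + h)%C - g z - h * m)
          + h * l * (g (z + h)%C - g z))%C by ring.
  eapply Rle_trans; [apply Cmod_triangle |].
  eapply Rle_trans; [apply Rplus_le_compat_r, Cmod_triangle |].
  rewrite !Cmod_mult.
  assert (B1 : Cmod (f (z + h)%C - f z - h * l) * Cmod (g z + (g (z + h)%C - g z)) <= eps / 3 * Cmod h).
  { apply Rle_trans with (eps / 3 / A * Cmod h * A); [| apply Req_le; field; lra].
    apply Rmult_le_compat; try apply Cmod_ge_0; [exact Hf' |].
    eapply Rle_trans; [apply Cmod_triangle |]. unfold A.
    assert ((Cmod m + 1) * Cmod h <= (Cmod m + 1) * 1) by (apply Rmult_le_compat_l; lra). lra. }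
  assert (B2 : Cmod (f z) * Cmod (g (z + h)%C - g z - h * m) <= eps / 3 * Cmod h).
  { apply Rle_trans with (B * (eps / 3 / B * Cmod h)); [| apply Req_le; field; lra].
    apply Rmult_le_compat; try apply Cmod_ge_0; [unfold B; lra | exact Hg']. }
  assert (B3 : Cmod h * Cmod l * Cmod (g (z + h)%C - g z) <= eps / 3 * Cmod h).
  { apply Rle_trans with (Cmod h * Cmod l * ((Cmod m + 1) * Cmod h)).
    { apply Rmult_le_compat_l; [nra | exact Lg]. }
    apply Rle_trans with (Cmod h * (D * (eps / 3 / D))); [| apply Req_le; field; lra].
    replace (Cmod h * Cmod l * ((Cmod m + 1) * Cmod h))
      with (Cmod h * ((Cmod l * (Cmod m + 1)) * Cmod h)) by ring.
    apply Rmult_le_compat_l; [exact Hh0 |].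
    apply Rmult_le_compat; [nra | lra | unfold D; lra | lra]. }
  lra.
Qed.

(** * Integrals of complex-valued functions *)

(** Taken componentwise, so that comparison, Chasles and the fundamental theorem come from real
    integrals. *)
Definition is_CInt (F : R -> C) (a b : R) (l : C) : Prop :=
  is_RInt (fun t => fst (F t)) a b (fst l) /\ is_RInt (fun t => snd (F t)) a b (snd l).

Definition CInt (F : R -> C) (a b : R) : C :=
  (RInt (fun t => fst (F t)) a b, RInt (fun t => snd (F t)) a b).

Definition Ccont (F : R -> C) (t : R) : Prop :=
  continuous (fun t => fst (F t)) t /\ continuous (fun t => snd (F t)) t.

Lemma is_CInt_unique (F : R -> C) (a b : R) (l : C) : is_CInt F a b l -> CInt F a b = l.
Proof.
  intros [H1 H2]. unfold CInt.
  rewrite (@is_RInt_unique R_CompleteNormedModule _ _ _ _ H1).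
  rewrite (@is_RInt_unique R_CompleteNormedModule _ _ _ _ H2).
  now destruct l.
Qed.

Lemma CInt_correct (F : R -> C) (a b : R) :
  a <= b -> (forall t, a <= t <= b -> Ccont F t) -> is_CInt F a b (CInt F a b).
Proof.
  intros Hab HF. split; apply (@RInt_correct R_CompleteNormedModule);
    apply (@ex_RInt_continuous R_CompleteNormedModule);
    rewrite Rmin_left, Rmax_right by lra; intros t Ht; now apply HF.
Qed.

Lemma is_CInt_plus (F G : R -> C) (a b : R) (l m : C) :
  is_CInt F a b l -> is_CInt G a b m -> is_CInt (fun t => F t + G t)%C a b (l + m).
Proof. intros [H1 H2] [H3 H4]. split; now apply (is_RInt_plus (V := R_NormedModule)). Qed.

Lemma is_CInt_scal (F : R -> C) (a b : R) (c l : C) :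
  is_CInt F a b l -> is_CInt (fun t => c * F t)%C a b (c * l).
Proof.
  intros [H1 H2]. split; simpl.
  - apply (is_RInt_minus (V := R_NormedModule)); now apply (is_RInt_scal (V := R_NormedModule)).
  - apply (is_RInt_plus (V := R_NormedModule)); now apply (is_RInt_scal (V := R_NormedModule)).
Qed.

Lemma is_CInt_ext (F G : R -> C) (a b : R) (l : C) :
  a <= b -> (forall t, a <= t <= b -> F t = G t) -> is_CInt F a b l -> is_CInt G a b l.
Proof.
  intros Hab E [H1 H2]. split; (eapply is_RInt_ext; [| eassumption]);
    rewrite Rmin_left, Rmax_right by lra; intros t Ht; simpl; now rewrite E by lra.
Qed.

Lemma is_CInt_Chasles (F : R -> C) (a b c : R) (l m : C) :
  is_CInt F a b l -> is_CInt F b c m -> is_CInt F a c (l + m).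
Proof.
  intros [H1 H2] [H3 H4].
  split; eapply (is_RInt_Chasles (V := R_NormedModule)); eassumption.
Qed.

Lemma Cmod_le_Rabs (z : C) : Cmod z <= Rabs (fst z) + Rabs (snd z).
Proof.
  unfold Cmod. assert (H1 := Rabs_pos (fst z)). assert (H2 := Rabs_pos (snd z)).
  rewrite <- (sqrt_Rsqr (Rabs (fst z) + Rabs (snd z))) by lra.
  apply sqrt_le_1_alt. unfold Rsqr.
  rewrite <- (pow2_abs (fst z)), <- (pow2_abs (snd z)). nra.
Qed.

Lemma Rabs_fst_le (z : C) : Rabs (fst z) <= Cmod z.
Proof. eapply Rle_trans; [apply Rmax_l | apply Rmax_Cmod]. Qed.

Lemma Rabs_snd_le (z : C) : Rabs (snd z) <= Cmod z.
Proof. eapply Rle_trans; [apply Rmax_r | apply Rmax_Cmod]. Qed.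

(** The factor 2 is the price of bounding the two components separately. It is harmless, since the
    bound only serves to show that quantities are arbitrarily small. *)
Lemma is_CInt_bound (F : R -> C) (a b M : R) (l : C) :
  a <= b -> (forall t, a <= t <= b -> Cmod (F t) <= M) -> is_CInt F a b l ->
  Cmod l <= 2 * ((b - a) * M).
Proof.
  intros Hab HM [H1 H2]. eapply Rle_trans; [apply Cmod_le_Rabs |].
  assert (B1 : Rabs (fst l) <= (b - a) * M).
  { eapply (norm_RInt_le_const (V := R_NormedModule)); [exact Hab | | exact H1].
    intros t Ht. eapply Rle_trans; [apply Rabs_fst_le | now apply HM]. }
  assert (B2 : Rabs (snd l) <= (b - a) * M).
  { eapply (norm_RInt_le_const (V := R_NormedModule)); [exact Hab | | exact H2].
    intros t Ht. eapply Rle_trans; [apply Rabs_snd_le | now apply HM]. }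
  lra.
Qed.

(** The passage from complex to real differentiation. It yields continuity on the sides of
    rectangles, and lets two functions be compared by differentiating along a segment from 0. *)
Lemma Cder_line (F : C -> C) (c v l : C) (t0 : R) :
  Cder F (c + t0 * v)%C l ->
  is_derive (fun t : R => fst (F (c + t * v)%C)) t0 (fst (v * l)%C) /\
  is_derive (fun t : R => snd (F (c + t * v)%C)) t0 (snd (v * l)%C).
Proof.
  intros H.
  (* One estimate on the modulus of the remainder dominates both components. *)
  assert (K : forall eps : posreal, locally t0 (fun t : R =>
     Cmod (F (c + t * v)%C - F (c + t0 * v)%C - (t - t0)%R * (v * l)) <= eps * Rabs (t - t0))).
  { intros eps. assert (Hv := Cmod_ge_0 v).
    destruct (H (eps / (Cmod v + 1))) as (d & Hd & Hf).
    { apply Rdiv_lt_0_compat; [apply cond_pos | lra]. }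
    assert (Hd' : 0 < d / (Cmod v + 1)) by (apply Rdiv_lt_0_compat; lra).
    exists (mkposreal _ Hd'). intros t Ht.
    change (Rabs (t - t0) < d / (Cmod v + 1)) in Ht.
    assert (E : Cmod ((t - t0)%R * v) = Rabs (t - t0) * Cmod v) by (now rewrite Cmod_mult, Cmod_R).
    assert (Hp := Rabs_pos (t - t0)).
    assert (L : Cmod ((t - t0)%R * v) < d).
    { rewrite E. apply Rle_lt_trans with (Rabs (t - t0) * (Cmod v + 1)); [nra |].
      apply (Rmult_lt_compat_r (Cmod v + 1)) in Ht; [| lra].
      unfold Rdiv in Ht. rewrite Rmult_assoc, Rinv_l in Ht; lra. }
    specialize (Hf _ L). rewrite E in Hf.
    replace (c + t0 * v + (t - t0)%R * v)%C with (c + t * v)%C in Hf by (rewrite RtoC_minus; ring).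
    replace ((t - t0)%R * (v * l))%C with ((t - t0)%R * v * l)%C by ring.
    eapply Rle_trans; [exact Hf |].
    apply Rle_trans with (eps / (Cmod v + 1) * (Rabs (t - t0) * (Cmod v + 1))).
    - apply Rmult_le_compat_l; [| nra].
      apply Rlt_le, Rdiv_lt_0_compat; [apply cond_pos | lra].
    - apply Req_le; field; lra. }
  split; (split; [apply is_linear_scal_l |]);
    intros x Hx eps; apply (is_filter_lim_locally_unique (V := R_NormedModule)) in Hx; subst x;
    (eapply filter_imp; [| exact (K eps)]); intros t Ht; (eapply Rle_trans; [| exact Ht]).
  - eapply Rle_trans; [| apply Rabs_fst_le]. apply Req_le. simpl. unfold norm; simpl.
    unfold abs; simpl. f_equal. unfold minus, plus, opp, scal, mult; simpl; unfold mult; simpl. ring.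
  - eapply Rle_trans; [| apply Rabs_snd_le]. apply Req_le. simpl. unfold norm; simpl.
    unfold abs; simpl. f_equal. unfold minus, plus, opp, scal, mult; simpl; unfold mult; simpl. ring.
Qed.

Lemma Cder_line_cont (F : C -> C) (c v l : C) (t0 : R) :
  Cder F (c + t0 * v)%C l -> Ccont (fun t : R => F (c + t * v)%C) t0.
Proof.
  intros H. destruct (Cder_line _ _ _ _ _ H) as [H1 H2].
  split; apply (ex_derive_continuous (V := R_NormedModule)); eexists; eassumption.
Qed.

(** * Bisection of rectangles *)

Lemma nested_intervals (a b : nat -> R) :
  (forall n, a n <= a (S n)) -> (forall n, b (S n) <= b n) -> (forall n, a n <= b n) ->
  exists x, forall n, a n <= x <= b n.
Proof.
  intros Ha Hb Hab.
  assert (Ma : forall n k, a n <= a (n + k)%nat).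
  { induction k; [rewrite Nat.add_0_r; lra |]. rewrite Nat.add_succ_r. eauto using Rle_trans. }
  assert (Mb : forall n k, b (n + k)%nat <= b n).
  { induction k; [rewrite Nat.add_0_r; lra |]. rewrite Nat.add_succ_r. eauto using Rle_trans. }
  assert (Mab : forall n m, a n <= b m).
  { intros n m. apply Rle_trans with (a (n + m)%nat); [apply Ma |].
    apply Rle_trans with (b (n + m)%nat); [apply Hab |]. rewrite Nat.add_comm. apply Mb. }
  destruct (completeness (fun x => exists n, x = a n)) as [x [Hu Hl]].
  - exists (b 0%nat). intros y [n ->]. apply Mab.
  - exists (a 0%nat), 0%nat. reflexivity.
  - exists x. intros n. split; [apply Hu; now exists n |].
    apply Hl. intros y [m ->]. apply Mab.
Qed.

Definition rect : Type := (R * R) * (R * R).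

Definition on_rect (E : R -> R -> R -> R -> C) (r : rect) : C :=
  E (fst (fst r)) (snd (fst r)) (fst (snd r)) (snd (snd r)).

(** Keeps the left half if it carries at least half of the modulus; if not, additivity and the
    triangle inequality show that the right half does. *)
Definition bisect_x (E : R -> R -> R -> R -> C) (r : rect) : rect :=
  let '((a, b), (c, d)) := r in
  if Rle_dec (Cmod (E a b c d) / 2) (Cmod (E a ((a + b) / 2) c d))
  then ((a, (a + b) / 2), (c, d)) else (((a + b) / 2, b), (c, d)).

Definition bisect_y (E : R -> R -> R -> R -> C) (r : rect) : rect :=
  let '((a, b), (c, d)) := r in
  if Rle_dec (Cmod (E a b c d) / 2) (Cmod (E a b c ((c + d) / 2)))
  then ((a, b), (c, (c + d) / 2)) else ((a, b), ((c + d) / 2, d)).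

Lemma half_le_other (u v : C) : ~ (Cmod (u + v) / 2 <= Cmod u) -> Cmod (u + v) <= 2 * Cmod v.
Proof. intros H. assert (T := Cmod_triangle u v). lra. Qed.

Definition subrect (r r0 : rect) : Prop :=
  fst (fst r0) <= fst (fst r) <= snd (fst r) /\ snd (fst r) <= snd (fst r0) /\
  fst (snd r0) <= fst (snd r) <= snd (snd r) /\ snd (snd r) <= snd (snd r0).

Section Bisection.
Variable E : R -> R -> R -> R -> C.
Variable r0 : rect.
Hypothesis split_x : forall a m b c d, a <= m <= b -> subrect ((a, b), (c, d)) r0 ->
  E a b c d = (E a m c d + E m b c d)%C.
Hypothesis split_y : forall a b c m d, c <= m <= d -> subrect ((a, b), (c, d)) r0 ->
  E a b c d = (E a b c m + E a b m d)%C.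

Lemma bisect_spec (r : rect) (r' := bisect_y E (bisect_x E r)) : subrect r r0 ->
  subrect r' r /\ Cmod (on_rect E r) <= 4 * Cmod (on_rect E r') /\
  snd (fst r') - fst (fst r') = (snd (fst r) - fst (fst r)) / 2 /\
  snd (snd r') - fst (snd r') = (snd (snd r) - fst (snd r)) / 2.
Proof.
  assert (HX : forall r, subrect r r0 -> let r' := bisect_x E r in
    subrect r' r /\ Cmod (on_rect E r) <= 2 * Cmod (on_rect E r') /\
    snd (fst r') - fst (fst r') = (snd (fst r) - fst (fst r)) / 2 /\
    snd r' = snd r).
  { clear r r'. intros [[a b] [c d]] Hr. unfold bisect_x, on_rect.
    assert (Hs := split_x a ((a + b) / 2) b c d).
    unfold subrect in *; simpl in *.
    destruct Rle_dec as [h | h]; simpl; rewrite Hs in h by lra; rewrite Hs by lra.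
    - repeat split; lra.
    - apply half_le_other in h. repeat split; lra. }
  assert (HY : forall r, subrect r r0 -> let r' := bisect_y E r in
    subrect r' r /\ Cmod (on_rect E r) <= 2 * Cmod (on_rect E r') /\
    snd (snd r') - fst (snd r') = (snd (snd r) - fst (snd r)) / 2 /\
    fst r' = fst r).
  { clear r r'. intros [[a b] [c d]] Hr. unfold bisect_y, on_rect.
    assert (Hs := split_y a b c ((c + d) / 2) d).
    unfold subrect in *; simpl in *.
    destruct Rle_dec as [h | h]; simpl; rewrite Hs in h by lra; rewrite Hs by lra.
    - repeat split; lra.
    - apply half_le_other in h. repeat split; lra. }
  intros Hr. destruct (HX r Hr) as (S1 & M1 & L1 & E1).
  assert (Hr1 : subrect (bisect_x E r) r0) by (unfold subrect in *; lra).
  destruct (HY _ Hr1) as (S2 & M2 & L2 & E2). fold r' in S2, M2, L2, E2.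
  rewrite E1 in L2. rewrite <- E2 in L1.
  unfold subrect in *. repeat split; lra.
Qed.

(** Each bisection divides the modulus of [E] by at most 4 and the squared size by exactly 4. At the
    common point of the nested rectangles [E] is negligible against the squared size, so its value
    on [r0] is too. *)
Lemma additive_rect_zero : subrect r0 r0 ->
  (forall x y eps, fst (fst r0) <= x <= snd (fst r0) -> fst (snd r0) <= y <= snd (snd r0) ->
     0 < eps -> exists delta, 0 < delta /\ forall a b c d,
       subrect ((a, b), (c, d)) r0 -> a <= x <= b -> c <= y <= d ->
       b - a < delta -> d - c < delta ->
       Cmod (E a b c d) <= eps * ((b - a) + (d - c)) ^ 2) ->
  on_rect E r0 = 0%C.
Proof.
  intros H0 Hloc.
  set (rs := fix rs n := match n with O => r0 | S n => bisect_y E (bisect_x E (rs n)) end).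
  assert (Hsub : forall n, subrect (rs n) r0).
  { induction n as [| n IH]; [exact H0 |].
    destruct (bisect_spec _ IH) as (S1 & _). simpl. unfold subrect in *. lra. }
  assert (Hstep := fun n => bisect_spec _ (Hsub n)).
  change (forall n, subrect (rs (S n)) (rs n) /\
    Cmod (on_rect E (rs n)) <= 4 * Cmod (on_rect E (rs (S n))) /\
    snd (fst (rs (S n))) - fst (fst (rs (S n))) = (snd (fst (rs n)) - fst (fst (rs n))) / 2 /\
    snd (snd (rs (S n))) - fst (snd (rs (S n))) = (snd (snd (rs n)) - fst (snd (rs n))) / 2)
    in Hstep.
  destruct (nested_intervals (fun n => fst (fst (rs n))) (fun n => snd (fst (rs n)))) as [x Hx];
    try (intros n; destruct (Hstep n) as [S1 _]; specialize (Hsub n); unfold subrect in *; lra).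
  destruct (nested_intervals (fun n => fst (snd (rs n))) (fun n => snd (snd (rs n)))) as [y Hy];
    try (intros n; destruct (Hstep n) as [S1 _]; specialize (Hsub n); unfold subrect in *; lra).
  set (Lx := snd (fst r0) - fst (fst r0)). set (Ly := snd (snd r0) - fst (snd r0)).
  assert (Hp : forall n, 0 < 2 ^ n) by (intros n; apply pow_lt; lra).
  assert (Hlen : forall n, snd (fst (rs n)) - fst (fst (rs n)) = Lx / 2 ^ n /\
                           snd (snd (rs n)) - fst (snd (rs n)) = Ly / 2 ^ n).
  { induction n as [| n [I1 I2]]; [unfold Lx, Ly; simpl; split; field |].
    destruct (Hstep n) as (_ & _ & -> & ->). rewrite I1, I2. simpl. specialize (Hp n).
    split; field; lra. }
  assert (Hmod : forall n, Cmod (on_rect E r0) <= 4 ^ n * Cmod (on_rect E (rs n))).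
  { induction n as [| n IH]; [simpl; lra |].
    destruct (Hstep n) as (_ & M & _). eapply Rle_trans; [exact IH |].
    rewrite <- tech_pow_Rmult.
    replace (4 * 4 ^ n * Cmod (on_rect E (rs (S n)))) with (4 ^ n * (4 * Cmod (on_rect E (rs (S n))))) by ring.
    apply Rmult_le_compat_l; [apply pow_le; lra | exact M]. }
  assert (HL : 0 <= Lx /\ 0 <= Ly) by (unfold Lx, Ly, subrect in *; lra).
  assert (Hsmall : forall eps, 0 < eps -> Cmod (on_rect E r0) <= eps * (Lx + Ly) ^ 2).
  { intros eps He.
    destruct (Hloc x y eps) as (delta & Hd & Hb); [apply (Hx 0%nat) | apply (Hy 0%nat) | exact He |].
    (* Since n + 1 <= 2^n, this many halvings make the rectangle smaller than [delta]. *)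
    destruct (nfloor_ex ((Lx + Ly) / delta)) as [n [_ Hn]].
    { apply Rdiv_le_0_compat; lra. }
    assert (Hn2 : (Lx + Ly) / 2 ^ n < delta).
    { assert (P : INR n + 1 <= 2 ^ n).
      { clear. induction n as [| n IH]; [simpl; lra |].
        rewrite S_INR, <- tech_pow_Rmult. pose proof (pos_INR n). lra. }
      specialize (Hp n). apply Rlt_div_l; [exact Hp |].
      apply Rlt_div_l in Hn; [| exact Hd]. nra. }
    specialize (Hsub n) as Hs. destruct (Hlen n) as [L1 L2].
    assert (Q1 : 0 <= Lx / 2 ^ n) by (apply Rdiv_le_0_compat; [lra | apply Hp]).
    assert (Q2 : 0 <= Ly / 2 ^ n) by (apply Rdiv_le_0_compat; [lra | apply Hp]).
    assert (Q3 : Lx / 2 ^ n + Ly / 2 ^ n = (Lx + Ly) / 2 ^ n) by (specialize (Hp n); field; lra).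
    assert (B := Hb (fst (fst (rs n))) (snd (fst (rs n))) (fst (snd (rs n))) (snd (snd (rs n)))).
    rewrite L1, L2, Q3 in B.
    eapply Rle_trans; [apply (Hmod n) |].
    apply Rle_trans with (4 ^ n * (eps * ((Lx + Ly) / 2 ^ n) ^ 2)).
    - apply Rmult_le_compat_l; [apply pow_le; lra |]. apply B; [exact Hs | apply Hx | apply Hy | lra | lra].
    - apply Req_le. replace 4 with (2 * 2) by ring. rewrite Rpow_mult_distr.
      specialize (Hp n). field. lra. }
  apply Cmod_eq_0.
  destruct (Rle_lt_or_eq_dec 0 _ (Cmod_ge_0 (on_rect E r0))) as [Hpos | ->]; [exfalso | reflexivity].
  set (m := Cmod (on_rect E r0)) in *.
  (* The rectangle may be degenerate; adding 1 keeps the divisor positive. *)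
  assert (P : 0 < (Lx + Ly) ^ 2 + 1) by nra.
  specialize (Hsmall (m / 2 / ((Lx + Ly) ^ 2 + 1)) ltac:(apply Rdiv_lt_0_compat; lra)).
  assert (m / 2 / ((Lx + Ly) ^ 2 + 1) * (Lx + Ly) ^ 2 <= m / 2).
  { apply Rle_trans with (m / 2 / ((Lx + Ly) ^ 2 + 1) * ((Lx + Ly) ^ 2 + 1)).
    - apply Rmult_le_compat_l; [apply Rlt_le, Rdiv_lt_0_compat; lra | lra].
    - apply Req_le; field; lra. }
  lra.
Qed.
End Bisection.

(** * Goursat's theorem *)

Definition horiz (G : C -> C) (y : R) (t : R) : C := G (t, y).
Definition vert (G : C -> C) (x : R) (t : R) : C := G (x, t).

(** The counterclockwise contour integral: bottom, right, top, left. The factor [Ci] is dz/dt on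
    vertical sides. *)
Definition boundary_int (G : C -> C) (a b c d : R) : C :=
  (CInt (horiz G c) a b + Ci * CInt (vert G b) c d
   - CInt (horiz G d) a b - Ci * CInt (vert G a) c d)%C.

Lemma horiz_cont (G : C -> C) (t y : R) :
  (exists l, Cder G (t, y) l) -> Ccont (horiz G y) t.
Proof.
  intros [l Hl].
  assert (E : forall s : R, ((0, y) + s * 1)%C = (s, y)).
  { intros s. apply injective_projections; simpl; ring. }
  rewrite <- (E t) in Hl. apply Cder_line_cont in Hl.
  unfold horiz. destruct Hl as [H1 H2].
  split; [eapply continuous_ext; [| exact H1] | eapply continuous_ext; [| exact H2]];
    intros s; cbv beta; now rewrite E.
Qed.

Lemma vert_cont (G : C -> C) (x t : R) :
  (exists l, Cder G (x, t) l) -> Ccont (vert G x) t.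
Proof.
  intros [l Hl].
  assert (E : forall s : R, ((x, 0) + s * Ci)%C = (x, s)).
  { intros s. apply injective_projections; simpl; ring. }
  rewrite <- (E t) in Hl. apply Cder_line_cont in Hl.
  unfold vert. destruct Hl as [H1 H2].
  split; [eapply continuous_ext; [| exact H1] | eapply continuous_ext; [| exact H2]];
    intros s; cbv beta; now rewrite E.
Qed.

Lemma is_RInt_affine (p q a b : R) :
  is_RInt (fun t => p + q * t) a b (p * (b - a) + q * (b ^ 2 - a ^ 2) / 2).
Proof.
  replace (p * (b - a) + q * (b ^ 2 - a ^ 2) / 2)
    with (minus (p * b + q * b ^ 2 / 2) (p * a + q * a ^ 2 / 2)).
  2: { unfold minus, plus, opp; simpl; field. }
  apply (is_RInt_derive (V := R_CompleteNormedModule) (fun t => p * t + q * t ^ 2 / 2)).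
  - intros t _. auto_derive; [trivial | field].
  - intros t _. apply (ex_derive_continuous (V := R_NormedModule)). auto_derive. trivial.
Qed.

(** With its vertical analogue, this shows by plain computation that an affine function has zero
    contour integral, without complex antiderivatives. *)
Lemma is_CInt_horiz_affine (u v : C) (y a b : R) :
  is_CInt (horiz (fun z => u + v * z)%C y) a b
    ((u + v * (Ci * y)) * (b - a) + v * ((b ^ 2 - a ^ 2) / 2))%C.
Proof.
  split; unfold horiz.
  - eapply is_RInt_ext;
      [| replace (fst _) with ((fst u - snd v * y) * (b - a) + fst v * (b ^ 2 - a ^ 2) / 2);
         [apply is_RInt_affine |]].
    + intros t _. simpl. ring.
    + simpl. field.
  - eapply is_RInt_ext;
      [| replace (snd _) with ((snd u + fst v * y) * (b - a) + snd v * (b ^ 2 - a ^ 2) / 2);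
         [apply is_RInt_affine |]].
    + intros t _. simpl. ring.
    + simpl. field.
Qed.

Lemma is_CInt_vert_affine (u v : C) (x c d : R) :
  is_CInt (vert (fun z => u + v * z)%C x) c d
    ((u + v * x) * (d - c) + v * Ci * ((d ^ 2 - c ^ 2) / 2))%C.
Proof.
  split; unfold vert.
  - eapply is_RInt_ext;
      [| replace (fst _) with ((fst u + fst v * x) * (d - c) + (- snd v) * (d ^ 2 - c ^ 2) / 2);
         [apply is_RInt_affine |]].
    + intros t _. simpl. ring.
    + simpl. field.
  - eapply is_RInt_ext;
      [| replace (snd _) with ((snd u + snd v * x) * (d - c) + fst v * (d ^ 2 - c ^ 2) / 2);
         [apply is_RInt_affine |]].
    + intros t _. simpl. ring.
    + simpl. field.
Qed.

Lemma is_CInt_minus (F G : R -> C) (a b : R) (l m : C) :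
  is_CInt F a b l -> is_CInt G a b m -> is_CInt (fun t => F t - G t)%C a b (l - m).
Proof. intros [H1 H2] [H3 H4]. split; now apply (is_RInt_minus (V := R_NormedModule)). Qed.

(** Contour integrals are additive under bisection, so only the local estimate is at stake. Near (x,
    y), subtracting the affine approximation leaves the contour integral unchanged and makes the
    integrand o(size), on a contour of length O(size). *)
Lemma Goursat (G : C -> C) (a b c d : R) : a <= b -> c <= d ->
  (forall x y, a <= x <= b -> c <= y <= d -> exists l, Cder G (x, y) l) ->
  boundary_int G a b c d = 0%C.
Proof.
  intros Hab Hcd HG.
  assert (IH : forall a' b' y, a <= a' -> a' <= b' -> b' <= b -> c <= y <= d ->
             is_CInt (horiz G y) a' b' (CInt (horiz G y) a' b')).
  { intros. apply CInt_correct; [assumption |]. intros t Ht. apply horiz_cont, HG; lra. }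
  assert (IV : forall c' d' x, c <= c' -> c' <= d' -> d' <= d -> a <= x <= b ->
             is_CInt (vert G x) c' d' (CInt (vert G x) c' d')).
  { intros. apply CInt_correct; [assumption |]. intros t Ht. apply vert_cont, HG; lra. }
  apply (additive_rect_zero (boundary_int G) ((a, b), (c, d))); unfold subrect; simpl; try lra.
  - intros a' m b' c' d' Hm (H1 & H2 & H3 & H4). unfold boundary_int.
    rewrite (is_CInt_unique _ _ _ _ (is_CInt_Chasles _ _ _ _ _ _ (IH a' m c' ltac:(lra) ltac:(lra) ltac:(lra) ltac:(lra)) (IH m b' c' ltac:(lra) ltac:(lra) ltac:(lra) ltac:(lra)))).
    rewrite (is_CInt_unique _ _ _ _ (is_CInt_Chasles _ _ _ _ _ _ (IH a' m d' ltac:(lra) ltac:(lra) ltac:(lra) ltac:(lra)) (IH m b' d' ltac:(lra) ltac:(lra) ltac:(lra) ltac:(lra)))).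
    ring.
  - intros a' b' c' m d' Hm (H1 & H2 & H3 & H4). unfold boundary_int.
    rewrite (is_CInt_unique _ _ _ _ (is_CInt_Chasles _ _ _ _ _ _ (IV c' m a' ltac:(lra) ltac:(lra) ltac:(lra) ltac:(lra)) (IV m d' a' ltac:(lra) ltac:(lra) ltac:(lra) ltac:(lra)))).
    rewrite (is_CInt_unique _ _ _ _ (is_CInt_Chasles _ _ _ _ _ _ (IV c' m b' ltac:(lra) ltac:(lra) ltac:(lra) ltac:(lra)) (IV m d' b' ltac:(lra) ltac:(lra) ltac:(lra) ltac:(lra)))).
    ring.
  - intros x y eps Hx Hy He.
    destruct (HG x y Hx Hy) as [l Hl].
    destruct (Hl (eps / 8)) as (delta & Hd & Hb); [lra |].
    (* Both sides below [delta / 2] keep [S], which bounds every distance to (x, y), below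
       [delta]. *)
    exists (delta / 2); split; [lra |].
    intros a' b' c' d' (H1 & H2 & H3 & H4) Hx' Hy' L1 L2.
    set (S := (b' - a') + (d' - c')).
    set (u := (G (x, y) - (x, y) * l)%C).
    set (A := fun z : C => (u + l * z)%C).
    assert (Dev : forall s t, a' <= s <= b' -> c' <= t <= d' ->
                  Cmod (G (s, t) - A (s, t)) <= eps / 8 * S).
    { intros s t Hs Ht.
      assert (Hh : Cmod ((s - x)%R, (t - y)%R) <= S).
      { eapply Rle_trans; [apply Cmod_le_Rabs |]. simpl.
        assert (Rabs (s - x) <= b' - a') by (apply Rabs_le; lra).
        assert (Rabs (t - y) <= d' - c') by (apply Rabs_le; lra). unfold S; lra. }
      assert (Hh' : Cmod ((s - x)%R, (t - y)%R) < delta) by (unfold S in *; lra).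
      specialize (Hb _ Hh').
      replace ((x, y) + ((s - x)%R, (t - y)%R))%C with ((s, t) : C) in Hb
        by (apply injective_projections; simpl; ring).
      replace (G (s, t) - A (s, t))%C with (G (s, t) - G (x, y) - ((s - x)%R, (t - y)%R) * l)%C.
      2: { unfold A, u. replace (((s - x)%R, (t - y)%R) : C) with ((s, t) - (x, y))%C
             by (apply injective_projections; simpl; ring). ring. }
      eapply Rle_trans; [exact Hb |]. apply Rmult_le_compat_l; [lra | exact Hh]. }
    assert (BH : forall t, c' <= t <= d' ->
       Cmod (CInt (horiz G t) a' b' - CInt (horiz A t) a' b') <= 2 * ((b' - a') * (eps / 8 * S))).
    { intros t Ht. eapply is_CInt_bound; [lra | | apply is_CInt_minus; [apply IH; lra |]].
      - intros s Hs. apply Dev; lra.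
      - unfold A. rewrite (is_CInt_unique _ _ _ _ (is_CInt_horiz_affine _ _ _ _ _)).
        apply is_CInt_horiz_affine. }
    assert (BV : forall s, a' <= s <= b' ->
       Cmod (CInt (vert G s) c' d' - CInt (vert A s) c' d') <= 2 * ((d' - c') * (eps / 8 * S))).
    { intros s Hs. eapply is_CInt_bound; [lra | | apply is_CInt_minus; [apply IV; lra |]].
      - intros t Ht. apply Dev; lra.
      - unfold A. rewrite (is_CInt_unique _ _ _ _ (is_CInt_vert_affine _ _ _ _ _)).
        apply is_CInt_vert_affine. }
    assert (ZA : boundary_int A a' b' c' d' = 0%C).
    { unfold boundary_int, A.
      rewrite !(is_CInt_unique _ _ _ _ (is_CInt_horiz_affine _ _ _ _ _)).
      rewrite !(is_CInt_unique _ _ _ _ (is_CInt_vert_affine _ _ _ _ _)).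
      apply injective_projections; simpl; field. }
    assert (EG : boundary_int G a' b' c' d' =
      ((CInt (horiz G c') a' b' - CInt (horiz A c') a' b')
       + Ci * (CInt (vert G b') c' d' - CInt (vert A b') c' d')
       + - (CInt (horiz G d') a' b' - CInt (horiz A d') a' b')
       + - (Ci * (CInt (vert G a') c' d' - CInt (vert A a') c' d')))%C).
    { transitivity (boundary_int G a' b' c' d' - boundary_int A a' b' c' d')%C;
        [rewrite ZA; ring | unfold boundary_int; ring]. }
    rewrite EG.
    eapply Rle_trans; [apply Cmod_triangle |].
    eapply Rle_trans; [apply Rplus_le_compat_r, Cmod_triangle |].
    eapply Rle_trans; [apply Rplus_le_compat_r, Rplus_le_compat_r, Cmod_triangle |].
    rewrite !Cmod_opp, !Cmod_mult, Cmod_Ci.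
    assert (B1 := BH c' ltac:(lra)). assert (B2 := BH d' ltac:(lra)).
    assert (B3 := BV a' ltac:(lra)). assert (B4 := BV b' ltac:(lra)).
    (* Two sides of each direction, each with the factor 2 of [is_CInt_bound], give the factor 4
       here; the total is half of what is allowed. *)
    assert (ES : 4 * ((b' - a') * (eps / 8 * S)) + 4 * ((d' - c') * (eps / 8 * S)) = eps * (S * (S * 1)) / 2)
      by (unfold S; field).
    assert (0 <= eps * (S * (S * 1)) / 2) by nra.
    lra.
Qed.

(** * The complex exponential *)

Definition Cexp (z : C) : C := (exp (fst z) * cos (snd z), exp (fst z) * sin (snd z)).

Lemma Cexp_plus (z w : C) : Cexp (z + w) = (Cexp z * Cexp w)%C.
Proof.
  unfold Cexp. apply injective_projections; simpl; rewrite exp_plus, ?cos_plus, ?sin_plus; ring.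
Qed.

Lemma Cexp_0 : Cexp 0 = 1%C.
Proof. unfold Cexp; simpl. rewrite exp_0, cos_0, sin_0. apply injective_projections; simpl; ring. Qed.

Lemma Cmod_Cexp (z : C) : Cmod (Cexp z) = exp (fst z).
Proof.
  unfold Cmod, Cexp; cbn [fst snd].
  replace (_ + _) with (Rsqr (exp (fst z))).
  - apply sqrt_Rsqr, Rlt_le, exp_pos.
  - assert (H := sin2_cos2 (snd z)). unfold Rsqr in *.
    transitivity (exp (fst z) * exp (fst z) * (sin (snd z) * sin (snd z) + cos (snd z) * cos (snd z)));
      [rewrite H |]; ring.
Qed.

Lemma Cexp_pow (z : C) (k : nat) : (Cexp z ^ k)%C = Cexp (INR k * z).
Proof.
  induction k as [| k IH].
  - simpl. rewrite <- Cexp_0. f_equal. ring.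
  - rewrite Cpow_S, IH, <- Cexp_plus, S_INR, RtoC_plus. f_equal. ring.
Qed.

Lemma derivable_pt_lim_0 (f : R -> R) (l : R) : derivable_pt_lim f 0 l ->
  forall eps, 0 < eps -> exists d, 0 < d /\
    forall h, Rabs h < d -> Rabs (f h - f 0 - h * l) <= eps * Rabs h.
Proof.
  intros H eps He. destruct (H eps He) as [d Hd].
  exists d; split; [apply cond_pos |]. intros h Hh.
  destruct (Req_dec h 0) as [-> | Hn].
  - replace (f 0 - f 0 - 0 * l) with 0 by ring. rewrite Rabs_R0. lra.
  - specialize (Hd h Hn Hh). rewrite Rplus_0_l in Hd.
    replace (f h - f 0 - h * l) with (((f h - f 0) / h - l) * h) by (field; exact Hn).
    rewrite Rabs_mult. apply Rmult_le_compat_r; [apply Rabs_pos | lra].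
Qed.

Lemma Cder_Cexp_0 : Cder Cexp 0 1.
Proof.
  intros eps He.
  (* With h = a + ib, the components of the remainder are split as (e^a - 1 - a) + e^a (cos b - 1)
     and e^a (sin b - b) + (e^a - 1) b. They cost 1 + 3 and 3 + 2 ninths of eps |h|; the cap 1
     serves to get |e^a| <= 3. *)
  destruct (derivable_pt_lim_0 _ _ derivable_pt_lim_exp_0 (Rmin (eps / 9) 1)) as (d1 & Hd1 & B1).
  { apply Rmin_glb_lt; lra. }
  destruct (derivable_pt_lim_0 _ _ derivable_pt_lim_cos_0 (eps / 9)) as (d2 & Hd2 & B2); [lra |].
  destruct (derivable_pt_lim_0 _ _ derivable_pt_lim_sin_0 (eps / 9)) as (d3 & Hd3 & B3); [lra |].
  exists (Rmin (Rmin d1 d2) (Rmin d3 (Rmin (eps / 9) 1))); split.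
  { repeat apply Rmin_glb_lt; lra. }
  intros h Hh.
  apply Rmin_Rgt_l in Hh as [Hh1 Hh2].
  apply Rmin_Rgt_l in Hh1 as [Hh1 Hh1'].
  apply Rmin_Rgt_l in Hh2 as [Hh2 Hh3].
  apply Rmin_Rgt_l in Hh3 as [Hh3 Hh4].
  rewrite Cexp_0. replace (0 + h)%C with h by ring.
  assert (Ha := Rabs_fst_le h). assert (Hb := Rabs_snd_le h).
  eapply Rle_trans; [apply Cmod_le_Rabs |].
  destruct h as [a b]. set (m := Cmod (a, b)) in *. simpl in Ha, Hb |- *.
  specialize (B1 a ltac:(lra)). specialize (B2 b ltac:(lra)). specialize (B3 b ltac:(lra)).
  rewrite exp_0 in B1. rewrite cos_0 in B2. rewrite sin_0 in B3.
  assert (M1 := Rmin_l (eps / 9) 1). assert (M2 := Rmin_r (eps / 9) 1).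
  assert (Pa := Rabs_pos a). assert (Pb := Rabs_pos b).
  set (e := Rmin (eps / 9) 1) in *. assert (0 < e) by (apply Rmin_glb_lt; lra).
  assert (X1 : Rabs (exp a - 1 - a * 1) <= eps / 9 * m).
  { eapply Rle_trans; [exact B1 |]. apply Rmult_le_compat; lra. }
  assert (X2 : Rabs (exp a - 1 - a * 1) <= Rabs a).
  { eapply Rle_trans; [exact B1 |]. rewrite <- (Rmult_1_l (Rabs a)) at 2. apply Rmult_le_compat_r; lra. }
  assert (X3 : Rabs (exp a - 1) <= 2 * Rabs a).
  { replace (exp a - 1) with ((exp a - 1 - a * 1) + a) by ring.
    eapply Rle_trans; [apply Rabs_triang |]. lra. }
  assert (X4 : Rabs (exp a) <= 3).
  { replace (exp a) with ((exp a - 1) + 1) by ring.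
    eapply Rle_trans; [apply Rabs_triang |]. rewrite (Rabs_right 1) by lra. lra. }
  assert (Y2 : Rabs (cos b - 1 - b * 0) <= eps / 9 * m).
  { eapply Rle_trans; [exact B2 |]. apply Rmult_le_compat_l; lra. }
  assert (Y3 : Rabs (sin b - 0 - b * 1) <= eps / 9 * m).
  { eapply Rle_trans; [exact B3 |]. apply Rmult_le_compat_l; lra. }
  assert (R1 : Rabs (exp a * cos b + - 1 + - (a * 1 - b * 0)) <= eps / 9 * m + 3 * (eps / 9 * m)).
  { replace (exp a * cos b + - 1 + - (a * 1 - b * 0))
      with ((exp a - 1 - a * 1) + exp a * (cos b - 1 - b * 0)) by ring.
    eapply Rle_trans; [apply Rabs_triang |]. rewrite Rabs_mult.
    apply Rplus_le_compat; [exact X1 |].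
    apply Rmult_le_compat; auto using Rabs_pos. }
  assert (R2 : Rabs (exp a * sin b + - 0 + - (a * 0 + b * 1)) <= 3 * (eps / 9 * m) + 2 * (eps / 9) * m).
  { replace (exp a * sin b + - 0 + - (a * 0 + b * 1))
      with (exp a * (sin b - 0 - b * 1) + (exp a - 1) * b) by ring.
    eapply Rle_trans; [apply Rabs_triang |]. rewrite !Rabs_mult.
    apply Rplus_le_compat.
    - apply Rmult_le_compat; auto using Rabs_pos.
    - apply Rmult_le_compat; auto using Rabs_pos; lra. }
  eapply Rle_trans; [apply Rplus_le_compat; [exact R1 | exact R2] |]. lra.
Qed.

Lemma Cder_Cexp (z : C) : Cder Cexp z (Cexp z).
Proof.
  intros eps He. assert (P : 0 < Cmod (Cexp z)) by (rewrite Cmod_Cexp; apply exp_pos).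
  destruct (Cder_Cexp_0 (eps / Cmod (Cexp z))) as (d & Hd & Hf); [now apply Rdiv_lt_0_compat |].
  exists d; split; [exact Hd |]. intros h Hh. specialize (Hf h Hh).
  rewrite Cexp_plus in Hf |- *. rewrite Cexp_0 in Hf.
  replace (Cexp z * Cexp h - Cexp z - h * Cexp z)%C
    with (Cexp z * (1 * Cexp h - 1 - h * 1))%C by ring.
  rewrite Cmod_mult.
  apply Rle_trans with (Cmod (Cexp z) * (eps / Cmod (Cexp z) * Cmod h)).
  - apply Rmult_le_compat_l; [lra | exact Hf].
  - apply Req_le. field. lra.
Qed.

Lemma sin_cos_2PI_INR (k : nat) : sin (INR k * (2 * PI)) = 0 /\ cos (INR k * (2 * PI)) = 1.
Proof.
  replace (INR k * (2 * PI)) with (0 + 2 * INR k * PI) by ring.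
  now rewrite sin_period, cos_period, sin_0, cos_0.
Qed.

Lemma sin_cos_2PI_diff (k n : nat) :
  sin ((INR k - INR n) * (2 * PI)) = 0 /\ cos ((INR k - INR n) * (2 * PI)) = 1.
Proof.
  destruct (sin_cos_2PI_INR k) as [A1 A2], (sin_cos_2PI_INR n) as [B1 B2].
  rewrite Rmult_minus_distr_r, sin_minus, cos_minus, A1, A2, B1, B2. lra.
Qed.

Lemma Cexp_R_mult (j s t : R) : Cexp (j * (s, t)) = (exp (j * s) * cos (j * t), exp (j * s) * sin (j * t)).
Proof. unfold Cexp; simpl. f_equal; f_equal; f_equal; ring. Qed.

Lemma is_RInt_cst (c a b : R) : is_RInt (fun _ => c) a b ((b - a) * c).
Proof. exact (is_RInt_const (V := R_NormedModule) a b c). Qed.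

Lemma is_CInt_Cexp (s : R) (k n : nat) :
  is_CInt (fun t => Cexp ((INR k - INR n)%R * (s, t))) 0 (2 * PI)
    (if Nat.eq_dec k n then RtoC (2 * PI) else 0%C).
Proof.
  destruct Nat.eq_dec as [-> | Hkn].
  - apply is_CInt_ext with (F := fun _ => 1%C).
    + pose proof PI_RGT_0; lra.
    + intros t _. replace (INR n - INR n) with 0 by ring.
      rewrite <- Cexp_0. f_equal. ring.
    + split; simpl.
      * assert (H := is_RInt_cst 1 0 (2 * PI)).
        now replace ((2 * PI - 0) * 1) with (2 * PI) in H by ring.
      * assert (H := is_RInt_cst 0 0 (2 * PI)).
        now replace ((2 * PI - 0) * 0) with 0 in H by ring.
  - set (j := INR k - INR n).
    assert (Hj : j <> 0) by (intros H; apply Hkn, INR_eq; unfold j in H; lra).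
    destruct (sin_cos_2PI_diff k n) as [S2 C2]. fold j in S2, C2.
    apply is_CInt_ext with (F := fun t => (exp (j * s) * cos (j * t), exp (j * s) * sin (j * t))).
    + pose proof PI_RGT_0; lra.
    + intros t _. symmetry. apply Cexp_R_mult.
    + split; cbn [fst snd].
      * replace (fst (RtoC 0)) with (minus (exp (j * s) * sin (j * (2 * PI)) / j) (exp (j * s) * sin (j * 0) / j)).
        2: { rewrite S2, !Rmult_0_r, sin_0. unfold minus, plus, opp; simpl. field. exact Hj. }
        apply (is_RInt_derive (V := R_CompleteNormedModule) (fun t => exp (j * s) * sin (j * t) / j)).
        -- intros t _. auto_derive; [trivial | field; exact Hj].
        -- intros t _. apply (ex_derive_continuous (V := R_NormedModule)). auto_derive. trivial.
      * replace (snd (RtoC 0)) with (minus (- exp (j * s) * cos (j * (2 * PI)) / j) (- exp (j * s) * cos (j * 0) / j)).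
        2: { rewrite C2, !Rmult_0_r, cos_0. unfold minus, plus, opp; simpl. field. exact Hj. }
        apply (is_RInt_derive (V := R_CompleteNormedModule) (fun t => - exp (j * s) * cos (j * t) / j)).
        -- intros t _. auto_derive; [trivial | field; exact Hj].
        -- intros t _. apply (ex_derive_continuous (V := R_NormedModule)). auto_derive. trivial.
Qed.

(** * Cauchy's coefficient formula *)

Definition poly3 (p : nat -> C) (z : C) : C :=
  (p 0%nat + p 1%nat * z + p 2%nat * z ^ 2 + p 3%nat * z ^ 3)%C.

(** Agreement up to O(z^4), with entries of [p] beyond index 3 ignored. The origin is excluded, so
    that identities obtained by dividing by z can be used as they are. *)
Definition jet (f : C -> C) (p : nat -> C) : Prop :=
  exists M delta : R, 0 <= M /\ 0 < delta /\
    forall z, 0 < Cmod z < delta -> Cmod (f z - poly3 p z) <= M * Cmod z ^ 4.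

Definition circle (r t : R) : C := (r * Cexp (0, t))%C.

Lemma Cexp_circle (s t : R) : Cexp (s, t) = circle (exp s) t.
Proof. unfold circle, Cexp; simpl. rewrite exp_0. apply injective_projections; simpl; ring. Qed.

Lemma is_CInt_poly3_Cexp (p : nat -> C) (n : nat) (s : R) : (n <= 3)%nat ->
  is_CInt (fun t => poly3 p (Cexp (s, t)) * Cexp (- INR n * (s, t)))%C 0 (2 * PI) (2 * PI * p n)%C.
Proof.
  intros Hn.
  assert (E : forall k, is_CInt (fun t => p k * (Cexp (s, t) ^ k * Cexp (- INR n * (s, t))))%C
    0 (2 * PI) (p k * if Nat.eq_dec k n then RtoC (2 * PI) else 0)).
  { intros k. apply is_CInt_scal. eapply is_CInt_ext; [| | apply (is_CInt_Cexp s)].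
    - pose proof PI_RGT_0; lra.
    - intros t _. cbv beta. rewrite Cexp_pow, <- Cexp_plus. f_equal.
      rewrite RtoC_minus. ring. }
  assert (A := is_CInt_plus _ _ _ _ _ _ (is_CInt_plus _ _ _ _ _ _ (is_CInt_plus _ _ _ _ _ _
    (E 0%nat) (E 1%nat)) (E 2%nat)) (E 3%nat)).
  replace (2 * PI * p n)%C with
   (p 0%nat * (if Nat.eq_dec 0 n then RtoC (2 * PI) else 0) +
    p 1%nat * (if Nat.eq_dec 1 n then RtoC (2 * PI) else 0) +
    p 2%nat * (if Nat.eq_dec 2 n then RtoC (2 * PI) else 0) +
    p 3%nat * (if Nat.eq_dec 3 n then RtoC (2 * PI) else 0))%C.
  - eapply is_CInt_ext; [| | exact A].
    + pose proof PI_RGT_0; lra.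
    + intros t _. cbv beta. unfold poly3. ring.
  - rewrite <- !RtoC_mult.
    do 4 (destruct n as [| n]; [simpl Nat.eq_dec; cbv beta iota; ring |]). lia.
Qed.

Section CauchyCoefficients.
Variables (g : C -> C) (p : nat -> C) (n : nat).
Hypothesis g_holo : forall z, Cmod z < 1 -> z <> 0%C -> exists l, Cder g z l.
Hypothesis g_jet : jet g p.
Hypothesis n_le : (n <= 3)%nat.

(** The pullback of g(z) z^(-n) under z = exp zeta. The punctured disk becomes a left half-plane,
    circles become vertical segments of length 2 pi, and nothing about [g] at 0 is required beyond
    its jet. *)
Let K (z : C) : C := (g (Cexp z) * Cexp (- INR n * z))%C.

Lemma log_pullback_holo (x y : R) : x < 0 -> exists l, Cder K (x, y) l.
Proof using g_holo.
  intros Hx.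
  destruct (g_holo (Cexp (x, y))) as [l Hl].
  - rewrite Cmod_Cexp. simpl. rewrite <- exp_0. now apply exp_increasing.
  - apply Cmod_gt_0. rewrite Cmod_Cexp. apply exp_pos.
  - eexists. unfold K. apply Cder_mult.
    + apply Cder_comp; [apply Cder_Cexp | exact Hl].
    + apply (Cder_comp Cexp (fun z => - INR n * z)%C); [| apply Cder_Cexp].
      apply Cder_mult; [apply Cder_const | apply Cder_id].
Qed.

Lemma log_pullback_period (x : R) : K (x, 2 * PI) = K (x, 0).
Proof.
  unfold K.
  replace ((x, 2 * PI) : C) with ((x, 0) + (0, (2 * PI)%R))%C by (apply injective_projections; simpl; ring).
  rewrite Cexp_plus.
  replace (Cexp (0, (2 * PI)%R)) with (RtoC 1).
  2: { unfold Cexp; simpl. rewrite exp_0, cos_2PI, sin_2PI. apply injective_projections; simpl; ring. }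
  rewrite Cmult_1_r. f_equal.
  replace (- INR n * ((x, 0) + (0, (2 * PI)%R)))%C with (- INR n * (x, 0) + (0, (- (INR n * (2 * PI)))%R))%C
    by (apply injective_projections; simpl; ring).
  rewrite Cexp_plus.
  replace (Cexp (0, (- (INR n * (2 * PI)))%R)) with (RtoC 1); [apply Cmult_1_r |].
  unfold Cexp; simpl. destruct (sin_cos_2PI_INR n) as [H1 H2].
  rewrite exp_0, cos_neg, sin_neg, H1, H2. apply injective_projections; simpl; ring.
Qed.

Lemma log_pullback_int_const (s s' : R) : s <= s' < 0 ->
  CInt (vert K s) 0 (2 * PI) = CInt (vert K s') 0 (2 * PI).
Proof using g_holo.
  intros Hs.
  assert (H : boundary_int K s s' 0 (2 * PI) = 0%C).
  { apply Goursat; [lra | pose proof PI_RGT_0; lra |].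
    intros x y Hx _. apply log_pullback_holo. lra. }
  unfold boundary_int in H.
  (* The horizontal sides cancel by periodicity, leaving the two vertical ones. *)
  replace (CInt (horiz K (2 * PI)) s s') with (CInt (horiz K 0) s s') in H.
  - assert (N : (Ci * (CInt (vert K s') 0 (2 * PI) - CInt (vert K s) 0 (2 * PI)))%C = 0%C).
    { rewrite <- H. ring. }
    assert (N' : (CInt (vert K s') 0 (2 * PI) - CInt (vert K s) 0 (2 * PI))%C = 0%C).
    { transitivity (- Ci * (Ci * (CInt (vert K s') 0 (2 * PI) - CInt (vert K s) 0 (2 * PI))))%C.
      - apply injective_projections; simpl; ring.
      - rewrite N. ring. }
    symmetry. now apply Ceq_minus.
  - apply is_CInt_unique. eapply is_CInt_ext; [lra | | apply CInt_correct; [lra |]].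
    + intros t _. cbv beta. unfold horiz. apply log_pullback_period.
    + intros t Ht. apply horiz_cont, log_pullback_holo. lra.
Qed.

Lemma log_pullback_int (s : R) : s < 0 ->
  is_CInt (vert K s) 0 (2 * PI) (2 * PI * p n)%C.
Proof using g_holo g_jet n_le.
  intros Hs.
  assert (HI : forall s, s < 0 -> is_CInt (vert K s) 0 (2 * PI) (CInt (vert K s) 0 (2 * PI))).
  { intros x Hx. apply CInt_correct; [pose proof PI_RGT_0; lra |].
    intros t _. apply vert_cont, log_pullback_holo, Hx. }
  replace (2 * PI * p n)%C with (CInt (vert K s) 0 (2 * PI)); [now apply HI |].
  apply Ceq_minus, Cmod_eq_0.
  destruct g_jet as (M & delta & HM & Hdelta & Hb).
  set (D := Cmod _).
  destruct (Rle_lt_or_eq_dec 0 D (Cmod_ge_0 _)) as [HD | <-]; [exfalso | reflexivity].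
  assert (PI0 := PI_RGT_0).
  (* A radius inside exp s and inside the domain of the jet, and so small that the remainder
     integral, at most 4 pi M r, falls below the supposed discrepancy [D]; M + 1 makes this
     strict. *)
  set (r := Rmin (exp s) (Rmin (delta / 2) (D / (2 * (2 * PI * (M + 1)))))).
  assert (HP : 0 < 2 * (2 * PI * (M + 1))).
  { assert (0 < PI * (M + 1)) by (apply Rmult_lt_0_compat; lra). lra. }
  assert (Hr : 0 < r).
  { repeat apply Rmin_glb_lt; [apply exp_pos | lra | now apply Rdiv_lt_0_compat]. }
  assert (Hr1 : r <= exp s) by apply Rmin_l.
  assert (Hr2 : r <= delta / 2) by (eapply Rle_trans; [apply Rmin_r | apply Rmin_l]).
  assert (Hr3 : r <= D / (2 * (2 * PI * (M + 1)))) by (eapply Rle_trans; [apply Rmin_r | apply Rmin_r]).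
  assert (Hes : exp s < 1) by (rewrite <- exp_0; now apply exp_increasing).
  set (u := ln r).
  assert (Eu : exp u = r) by now apply exp_ln.
  assert (Hu : u <= s).
  { destruct (Rle_lt_dec u s) as [h | h]; [exact h |]. apply exp_increasing in h. lra. }
  assert (BD : D <= 2 * ((2 * PI - 0) * (M * r))).
  { unfold D. rewrite <- (log_pullback_int_const u s) by lra.
    eapply is_CInt_bound; [lra | |
      apply is_CInt_minus; [apply HI; lra | apply (is_CInt_poly3_Cexp p n u n_le)]].
    intros t _. cbv beta. unfold vert, K.
    replace (g (Cexp (u, t)) * Cexp (- INR n * (u, t)) - poly3 p (Cexp (u, t)) * Cexp (- INR n * (u, t)))%C
      with ((g (Cexp (u, t)) - poly3 p (Cexp (u, t))) * Cexp (- INR n * (u, t)))%C by ring.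
    rewrite Cmod_mult.
    assert (Z : Cmod (Cexp (u, t)) = r) by (rewrite Cmod_Cexp; exact Eu).
    assert (W : r ^ n * Cmod (Cexp (- INR n * (u, t))) = 1).
    { rewrite <- Z, <- Cmod_pow, <- Cmod_mult, Cexp_pow, <- Cexp_plus.
      replace (INR n * (u, t) + - INR n * (u, t))%C with (RtoC 0) by ring. now rewrite Cexp_0, Cmod_1. }
    assert (B := Hb (Cexp (u, t)) ltac:(rewrite Z; lra)). rewrite Z in B.
    (* The second factor is r^(-n), and n <= 3 leaves at least one power of r. *)
    assert (V : r ^ 4 * Cmod (Cexp (- INR n * (u, t))) <= r).
    { replace (r ^ 4) with (r * r ^ (3 - n) * r ^ n).
      - rewrite Rmult_assoc, W, Rmult_1_r. rewrite <- (Rmult_1_r r) at 3.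
        apply Rmult_le_compat_l; [lra |].
        rewrite <- (pow1 (3 - n)). apply pow_incr. lra.
      - rewrite Rmult_assoc, <- pow_add. replace (3 - n + n)%nat with 3%nat by lia. ring. }
    apply Rle_trans with (M * r ^ 4 * Cmod (Cexp (- INR n * (u, t)))).
    - apply Rmult_le_compat_r; [apply Cmod_ge_0 | exact B].
    - rewrite Rmult_assoc. now apply Rmult_le_compat_l. }
  assert (X : 2 * (2 * PI * (M + 1)) * r <= D).
  { apply (Rmult_le_compat_l (2 * (2 * PI * (M + 1)))) in Hr3; [| lra].
    replace (2 * (2 * PI * (M + 1)) * (D / (2 * (2 * PI * (M + 1))))) with D in Hr3 by (field; lra).
    exact Hr3. }
  assert (0 < PI * r) by (apply Rmult_lt_0_compat; lra).
  lra.
Qed.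

(** On the circle, conj(z)^n = r^(2n) z^(-n). Written with conjugates, Cauchy's formula becomes an
    inner product with a monomial. *)
Lemma Cauchy_coef (r : R) : 0 < r < 1 ->
  is_CInt (fun t => g (circle r t) * Cconj (circle r t) ^ n)%C 0 (2 * PI) (2 * PI * p n * r ^ (2 * n))%C.
Proof using g_holo g_jet n_le.
  intros Hr.
  assert (Hs : ln r < 0) by (rewrite <- ln_1; apply ln_increasing; lra).
  assert (H := log_pullback_int _ Hs). apply (is_CInt_scal _ _ _ (r ^ (2 * n))%C) in H.
  rewrite (Cmult_comm (r ^ (2 * n))) in H.
  eapply is_CInt_ext; [| | exact H]; [pose proof PI_RGT_0; lra |].
  intros t _. cbv beta. unfold vert, K.
  rewrite Cexp_circle, exp_ln by lra.
  set (z := circle r t).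
  assert (Hz : Cmod z = r).
  { unfold z, circle. rewrite Cmod_mult, Cmod_R, Cmod_Cexp. simpl. rewrite exp_0, Rabs_right; lra. }
  assert (E1 : (r ^ (2 * n))%C = (z ^ n * Cconj z ^ n)%C).
  { rewrite Cpow_mult_r, <- Cpow_mult_l. f_equal. rewrite <- Cmod2_conj, Hz. now rewrite RtoC_pow. }
  assert (E2 : (z ^ n * Cexp (- INR n * (ln r, t)))%C = 1%C).
  { unfold z. rewrite <- (exp_ln r) at 1 by lra. rewrite <- Cexp_circle, Cexp_pow, <- Cexp_plus.
    rewrite <- Cexp_0. f_equal. ring. }
  rewrite E1.
  transitivity (g z * Cconj z ^ n * (z ^ n * Cexp (- INR n * (ln r, t))))%C; [ring |].
  rewrite E2. ring.
Qed.
End CauchyCoefficients.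

(** * Contraction of the Toeplitz matrix of a Schwarz function *)

Definition sum4 (p : nat -> C) : C := (p 0%nat + p 1%nat + p 2%nat + p 3%nat)%C.

(* Meaningful for n <= 3 only. *)
Definition cauchy_prod (p q : nat -> C) (n : nat) : C :=
  match n with
  | 0%nat => p 0%nat * q 0%nat
  | 1%nat => p 0%nat * q 1%nat + p 1%nat * q 0%nat
  | 2%nat => p 0%nat * q 2%nat + p 1%nat * q 1%nat + p 2%nat * q 0%nat
  | _ => p 0%nat * q 3%nat + p 1%nat * q 2%nat + p 2%nat * q 1%nat + p 3%nat * q 0%nat
  end%C.

Definition coef_bound (p : nat -> C) : R :=
  Cmod (p 0%nat) + Cmod (p 1%nat) + Cmod (p 2%nat) + Cmod (p 3%nat).

Lemma coef_bound_ge_0 (p : nat -> C) : 0 <= coef_bound p.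
Proof. unfold coef_bound. repeat apply Rplus_le_le_0_compat; apply Cmod_ge_0. Qed.

Lemma poly3_bound (p : nat -> C) (z : C) : Cmod z <= 1 -> Cmod (poly3 p z) <= coef_bound p.
Proof.
  intros Hz. unfold poly3, coef_bound.
  assert (B : forall (c : C) k, Cmod (c * z ^ k) <= Cmod c).
  { intros c k. rewrite Cmod_mult, Cmod_pow. rewrite <- (Rmult_1_r (Cmod c)) at 2.
    apply Rmult_le_compat_l; [apply Cmod_ge_0 |]. rewrite <- (pow1 k).
    apply pow_incr. split; [apply Cmod_ge_0 | exact Hz]. }
  assert (B1 := B (p 1%nat) 1%nat). rewrite Cpow_1_r in B1.
  eapply Rle_trans; [apply Cmod_triangle |]. apply Rplus_le_compat; [| apply B].
  eapply Rle_trans; [apply Cmod_triangle |]. apply Rplus_le_compat; [| apply B].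
  eapply Rle_trans; [apply Cmod_triangle |]. apply Rplus_le_compat_l, B1.
Qed.

Lemma jet_mult (f g : C -> C) (p q : nat -> C) :
  jet f p -> jet g q -> jet (fun z => f z * g z)%C (cauchy_prod p q).
Proof.
  intros (M & d & HM & Hd & Hf) (N & e & HN & He & Hg).
  (* The terms of degree 4 to 6 in the product of the two cubics, after division by z^4. *)
  set (T := fun n : nat => match n with
     | 0%nat => p 1%nat * q 3%nat + p 2%nat * q 2%nat + p 3%nat * q 1%nat
     | 1%nat => p 2%nat * q 3%nat + p 3%nat * q 2%nat
     | 2%nat => p 3%nat * q 3%nat
     | _ => 0 end%C).
  assert (Kp := coef_bound_ge_0 p). assert (Kq := coef_bound_ge_0 q).
  assert (KT := coef_bound_ge_0 T).
  assert (H1 : 0 <= M * (N + coef_bound q)) by (apply Rmult_le_pos; lra).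
  assert (H2 : 0 <= coef_bound p * N) by (apply Rmult_le_pos; lra).
  exists (M * (N + coef_bound q) + coef_bound p * N + coef_bound T), (Rmin (Rmin d e) 1).
  split; [lra |]. split; [repeat apply Rmin_glb_lt; lra |].
  intros z [Hz0 Hz].
  apply Rmin_Rgt_l in Hz as [Hz Hz1]. apply Rmin_Rgt_l in Hz as [Hzd Hze].
  specialize (Hf z (conj Hz0 Hzd)). specialize (Hg z (conj Hz0 Hze)).
  set (x := Cmod z ^ 4) in *.
  assert (Hx : 0 <= x) by (apply pow_le; lra).
  assert (Hx1 : x <= 1) by (unfold x; rewrite <- (pow1 4); apply pow_incr; lra).
  assert (Bp := poly3_bound p z ltac:(lra)). assert (Bq := poly3_bound q z ltac:(lra)).
  assert (BT := poly3_bound T z ltac:(lra)).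
  replace (f z * g z - poly3 (cauchy_prod p q) z)%C with
    ((f z - poly3 p z) * ((g z - poly3 q z) + poly3 q z) + poly3 p z * (g z - poly3 q z)
      + z ^ 4 * poly3 T z)%C by (unfold poly3, cauchy_prod, T; ring).
  eapply Rle_trans; [apply Cmod_triangle |].
  eapply Rle_trans; [apply Rplus_le_compat_r, Cmod_triangle |].
  rewrite !Cmod_mult, Cmod_pow. fold x.
  rewrite !Rmult_plus_distr_r.
  apply Rplus_le_compat; [apply Rplus_le_compat |].
  - replace (M * (N + coef_bound q) * x) with (M * x * (N + coef_bound q)) by ring.
    apply Rmult_le_compat; try apply Cmod_ge_0; [exact Hf |].
    eapply Rle_trans; [apply Cmod_triangle |]. nra.
  - rewrite Rmult_assoc. apply Rmult_le_compat; auto using Cmod_ge_0.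
  - rewrite Rmult_comm. apply Rmult_le_compat_r; assumption.
Qed.

Lemma jet_poly3 (p : nat -> C) : jet (poly3 p) p.
Proof.
  exists 0, 1. repeat split; try lra. intros z _.
  replace (poly3 p z - poly3 p z)%C with (RtoC 0) by ring. rewrite Cmod_0. lra.
Qed.

Lemma Cder_poly3 (p : nat -> C) (z : C) : exists l, Cder (poly3 p) z l.
Proof.
  eexists. unfold poly3. simpl.
  repeat first [apply Cder_plus | apply Cder_mult | apply Cder_id | apply Cder_const].
Qed.

(** The normalized L^2 inner product on the circle of radius r between a function with jet [p] and
    the cubic [t]: by orthogonality the higher coefficients of the function do not enter. *)
Definition circle_pairing (p t : nat -> C) (r : R) : C :=
  sum4 (fun n => (p n * Cconj (t n)) * r ^ (2 * n))%C.

Lemma is_CInt_circle_pairing (g : C -> C) (p t : nat -> C) (r : R) :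
  (forall z, Cmod z < 1 -> z <> 0%C -> exists l, Cder g z l) -> jet g p -> 0 < r < 1 ->
  is_CInt (fun s => g (circle r s) * Cconj (poly3 t (circle r s)))%C 0 (2 * PI)
    (2 * PI * circle_pairing p t r)%C.
Proof.
  intros Hg Hj Hr.
  assert (E : forall n, (n <= 3)%nat -> is_CInt
    (fun s => Cconj (t n) * (g (circle r s) * Cconj (circle r s) ^ n))%C 0 (2 * PI)
    (Cconj (t n) * (2 * PI * p n * r ^ (2 * n)))%C).
  { intros n Hn. apply is_CInt_scal. now apply Cauchy_coef. }
  assert (A := is_CInt_plus _ _ _ _ _ _ (is_CInt_plus _ _ _ _ _ _ (is_CInt_plus _ _ _ _ _ _
    (E 0%nat ltac:(lia)) (E 1%nat ltac:(lia))) (E 2%nat ltac:(lia))) (E 3%nat ltac:(lia))).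
  replace (2 * PI * circle_pairing p t r)%C with
   (Cconj (t 0%nat) * (2 * PI * p 0%nat * r ^ (2 * 0)) +
    Cconj (t 1%nat) * (2 * PI * p 1%nat * r ^ (2 * 1)) +
    Cconj (t 2%nat) * (2 * PI * p 2%nat * r ^ (2 * 2)) +
    Cconj (t 3%nat) * (2 * PI * p 3%nat * r ^ (2 * 3)))%C
    by (unfold circle_pairing, sum4; ring).
  eapply is_CInt_ext; [| | exact A]; [pose proof PI_RGT_0; lra |].
  intros s _. cbv beta. unfold poly3. rewrite !Cplus_conj, !Cmult_conj, !Cpow_conj. ring.
Qed.

Lemma fst_circle_pairing (p t : nat -> C) (r : R) :
  fst (circle_pairing p t r) = fst (p 0%nat * Cconj (t 0%nat))%C + fst (p 1%nat * Cconj (t 1%nat))%C * r ^ 2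
    + fst (p 2%nat * Cconj (t 2%nat))%C * r ^ 4 + fst (p 3%nat * Cconj (t 3%nat))%C * r ^ 6.
Proof.
  unfold circle_pairing, sum4. rewrite <- !RtoC_pow. simpl. ring.
Qed.

(** The limit r -> 1 is taken on the coefficients, since [w] is controlled only inside the disk. *)
Lemma even_poly_limit (a0 a1 a2 a3 : R) :
  (forall r, 0 < r < 1 -> 0 <= a0 + a1 * r ^ 2 + a2 * r ^ 4 + a3 * r ^ 6) ->
  0 <= a0 + a1 + a2 + a3.
Proof.
  intros H. destruct (Rle_lt_dec 0 (a0 + a1 + a2 + a3)) as [h | h]; [exact h | exfalso].
  set (S := - (a0 + a1 + a2 + a3)). set (m := Rabs a1 + Rabs a2 + Rabs a3 + 1).
  assert (P1 := Rabs_pos a1). assert (P2 := Rabs_pos a2). assert (P3 := Rabs_pos a3).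
  assert (Hm : 0 < m) by (unfold m; lra).
  (* With r = 1 - x, the powers r^2, r^4, r^6 differ from 1 by at most 6x, so the sum moves by at
     most half of its supposed defect [S]. *)
  set (x := Rmin (1 / 2) (S / (12 * m))).
  assert (Hx : 0 < x) by (apply Rmin_glb_lt; [lra | apply Rdiv_lt_0_compat; unfold S; lra]).
  assert (Hx1 : x <= 1 / 2) by apply Rmin_l.
  assert (Hx2 : 6 * x * m <= S / 2).
  { assert (B : x <= S / (12 * m)) by apply Rmin_r.
    apply (Rmult_le_compat_r (6 * m)) in B; [| lra].
    replace (S / (12 * m) * (6 * m)) with (S / 2) in B by (field; lra). lra. }
  specialize (H (1 - x) ltac:(lra)).
  set (s := (1 - x) ^ 2) in *.
  replace ((1 - x) ^ 4) with (s ^ 2) in H by (unfold s; ring).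
  replace ((1 - x) ^ 6) with (s ^ 3) in H by (unfold s; ring).
  assert (Hs : 1 - 2 * x <= s <= 1) by (unfold s; nra).
  assert (Hs0 : 0 <= s) by lra.
  assert (B1 : 0 <= 1 - s <= 6 * x) by lra.
  assert (B2 : 0 <= 1 - s ^ 2 <= 6 * x) by nra.
  assert (B3 : 0 <= 1 - s ^ 3 <= 6 * x).
  { replace (1 - s ^ 3) with ((1 - s) * (1 + s + s ^ 2)) by ring. nra. }
  assert (C : forall a u, 0 <= u <= 6 * x -> - (a * u) <= 6 * x * Rabs a).
  { intros a u Hu. assert (- a <= Rabs a) by (rewrite <- Rabs_Ropp; apply Rle_abs).
    assert (Q := Rabs_pos a). nra. }
  assert (C1 := C a1 _ B1). assert (C2 := C a2 _ B2). assert (C3 := C a3 _ B3).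
  unfold S, m in *. nra.
Qed.

Definition norm4 (p : nat -> C) : R :=
  Cmod (p 0%nat) ^ 2 + Cmod (p 1%nat) ^ 2 + Cmod (p 2%nat) ^ 2 + Cmod (p 3%nat) ^ 2.

Lemma fst_mult_conj (z : C) : fst (z * Cconj z)%C = Cmod z ^ 2.
Proof. now rewrite <- Cmod2_conj. Qed.

(* A multiplier bounded by 1 contracts the L^2 norm on every circle; comparing
   Fourier coefficients, the truncated Toeplitz matrix of w is a contraction. *)
Lemma toeplitz_contraction (w : C -> C) (c q : nat -> C) :
  (forall z, Cmod z < 1 -> exists l, Cder w z l) -> (forall z, Cmod z < 1 -> Cmod (w z) <= 1) ->
  jet w c -> norm4 (cauchy_prod c q) <= norm4 q.
Proof.
  intros Hw Hw1 Hj. set (t := cauchy_prod c q).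
  (* As [t] is the truncation of w q, pairing w q with [t] gives the pairing of [t] with itself.
     Integrating 2 Re(w q conj t) <= |q|^2 + |t|^2 thus replaces Bessel's inequality for w q. *)
  assert (Hr : forall r, 0 < r < 1 ->
    2 * fst (circle_pairing t t r) <= fst (circle_pairing q q r) + fst (circle_pairing t t r)).
  { intros r Hr. assert (HPI := PI_RGT_0).
    assert (Hwq : forall z, Cmod z < 1 -> z <> 0%C -> exists l, Cder (fun z => w z * poly3 q z)%C z l).
    { intros z Hz _. destruct (Hw z Hz) as [l Hl], (Cder_poly3 q z) as [m Hm].
      eexists. apply Cder_mult; eassumption. }
    assert (I1 := proj1 (is_CInt_circle_pairing _ t t r Hwq (jet_mult _ _ _ _ Hj (jet_poly3 q)) Hr)).
    assert (I2 := proj1 (is_CInt_circle_pairing _ q q r (fun z _ _ => Cder_poly3 q z) (jet_poly3 q) Hr)).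
    assert (I3 := proj1 (is_CInt_circle_pairing _ t t r (fun z _ _ => Cder_poly3 t z) (jet_poly3 t) Hr)).
    assert (H2PI : 0 <= 2 * PI) by lra.
    assert (L := is_RInt_le _ _ _ _ _ _ H2PI
      (is_RInt_scal (V := R_NormedModule) _ _ _ 2 _ I1)
      (is_RInt_plus (V := R_NormedModule) _ _ _ _ _ _ I2 I3)).
    assert (E : forall z : C, fst (2 * PI * z)%C = 2 * PI * fst z) by (intros; simpl; ring).
    rewrite !E in L.
    assert (L' : 2 * (2 * PI * fst (circle_pairing t t r)) <=
      2 * PI * fst (circle_pairing q q r) + 2 * PI * fst (circle_pairing t t r)).
    { apply L. intros s _. set (z := circle r s).
      assert (Hz : Cmod z < 1).
      { unfold z, circle. rewrite Cmod_mult, Cmod_R, Cmod_Cexp. simpl. rewrite exp_0, Rabs_right; lra. }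
      change (2 * fst (w z * poly3 q z * Cconj (poly3 t z))%C <=
        fst (poly3 q z * Cconj (poly3 q z))%C + fst (poly3 t z * Cconj (poly3 t z))%C).
      rewrite !fst_mult_conj.
      assert (B := Rabs_fst_le (w z * poly3 q z * Cconj (poly3 t z))).
      rewrite !Cmod_mult, Cmod_conj in B.
      assert (B1 := Rle_abs (fst (w z * poly3 q z * Cconj (poly3 t z))%C)).
      assert (B2 := Hw1 z Hz). assert (B3 := Cmod_ge_0 (w z)).
      assert (B4 := Cmod_ge_0 (poly3 q z)). assert (B5 := Cmod_ge_0 (poly3 t z)).
      assert (B6 : Cmod (w z) * Cmod (poly3 q z) * Cmod (poly3 t z) <= Cmod (poly3 q z) * Cmod (poly3 t z)).
      { rewrite <- (Rmult_1_l (Cmod (poly3 q z) * _)), Rmult_assoc.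
        apply Rmult_le_compat_r; [now apply Rmult_le_pos | exact B2]. }
      assert (B7 := pow2_ge_0 (Cmod (poly3 q z) - Cmod (poly3 t z))). nra. }
    apply (Rmult_le_reg_l (2 * PI)); lra. }
  assert (H : 0 <= (Cmod (q 0%nat) ^ 2 - Cmod (t 0%nat) ^ 2) + (Cmod (q 1%nat) ^ 2 - Cmod (t 1%nat) ^ 2)
    + (Cmod (q 2%nat) ^ 2 - Cmod (t 2%nat) ^ 2) + (Cmod (q 3%nat) ^ 2 - Cmod (t 3%nat) ^ 2)).
  { apply even_poly_limit. intros r h. specialize (Hr r h).
    rewrite !fst_circle_pairing, !fst_mult_conj in Hr. lra. }
  unfold norm4. lra.
Qed.

(** * Schur parameters *)

Lemma RtoC_Cmod2 (z : C) : RtoC (Cmod z ^ 2) = (z * Cconj z)%C.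
Proof. apply Cmod2_conj. Qed.

(* x and y are the second and third Schur parameters. They are read off the
   contraction inequality applied to truncations of the denominators in
   g_1 = (c_1 + z g_2) / (1 + conj c_1 z g_2), g_2 = (x + z g_3) / (1 + conj x z g_3). *)
Lemma schur_parameters (c1 c2 c3 : C) :
  (forall q0 q1 q2 : C,
     Cmod (c1 * q0) ^ 2 + Cmod (c1 * q1 + c2 * q0) ^ 2 + Cmod (c1 * q2 + c2 * q1 + c3 * q0) ^ 2
     <= Cmod q0 ^ 2 + Cmod q1 ^ 2 + Cmod q2 ^ 2) ->
  Cmod c1 <= 1 /\ exists x y : C, Cmod x <= 1 /\ Cmod y <= 1 /\
    c2 = ((1 - Cmod c1 ^ 2)%R * x)%C /\
    c3 = ((1 - Cmod c1 ^ 2)%R * (- Cconj c1 * x ^ 2 + (1 - Cmod x ^ 2)%R * y))%C.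
Proof.
  intros H. set (A := 1 - Cmod c1 ^ 2).
  assert (P1 := Cmod_ge_0 c1). assert (P2 := Cmod_ge_0 c2). assert (P3 := Cmod_ge_0 c3).
  assert (Hsq : forall u, 0 <= u -> u ^ 2 <= 1 -> u <= 1) by (intros; nra).
  assert (Hsum : Cmod c1 ^ 2 + Cmod c2 ^ 2 + Cmod c3 ^ 2 <= 1).
  { specialize (H 1%C 0%C 0%C). rewrite !Cmult_0_r, !Cplus_0_l, !Cmult_1_r, !Cmod_0, Cmod_1 in H. lra. }
  assert (Hc1 : Cmod c1 <= 1) by (apply Hsq; nra).
  split; [exact Hc1 |].
  assert (HA : 0 <= A) by (unfold A; nra).
  assert (EA : RtoC A = (1 - c1 * Cconj c1)%C) by (unfold A; rewrite RtoC_minus, RtoC_Cmod2; reflexivity).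
  destruct (Rle_lt_or_eq_dec 0 A HA) as [HA0 | HA0].
  (* When |c1| = 1, the first column of the matrix already forces c2 = c3 = 0. *)
  2: { exists 0%C, 0%C. rewrite Cmod_0. repeat split; try lra.
       - rewrite Cmult_0_r. apply Cmod_eq_0. unfold A in HA0. nra.
       - rewrite <- HA0. rewrite Cmult_0_l. apply Cmod_eq_0. unfold A in HA0. nra. }
  assert (NA : RtoC A <> 0%C) by (intros E; apply RtoC_inj in E; lra).
  set (x := (c2 / A)%C). set (s := (c3 / A + Cconj c1 * x ^ 2)%C).
  assert (E2 : c2 = (A * x)%C) by (unfold x; field; exact NA).
  assert (E3 : c3 = (A * (s - Cconj c1 * x ^ 2))%C) by (unfold s; field; exact NA).
  assert (Px := Cmod_ge_0 x). assert (Ps := Cmod_ge_0 s).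
  assert (Hxs : Cmod x ^ 2 + Cmod s ^ 2 <= 1).
  { specialize (H 1%C (Cconj c1 * x)%C (Cconj c1 * s)%C).
    replace (c1 * (Cconj c1 * x) + c2 * 1)%C with x in H by (rewrite E2, EA; ring).
    replace (c1 * (Cconj c1 * s) + c2 * (Cconj c1 * x) + c3 * 1)%C with s in H
      by (rewrite E3, E2, EA; ring).
    rewrite Cmult_1_r, !Cmod_mult, Cmod_1, Cmod_conj, !Rpow_mult_distr in H.
    unfold A in HA0. nra. }
  assert (Hx : Cmod x <= 1) by (apply Hsq; nra).
  destruct (Rle_lt_or_eq_dec 0 (1 - Cmod x ^ 2) ltac:(nra)) as [HB | HB].
  (* When |x| = 1, the previous inequality forces s = 0. *)
  2: { exists x, 0%C. rewrite Cmod_0. repeat split; try lra; [exact E2 |].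
       assert (Es : s = 0%C) by (apply Cmod_eq_0; nra).
       rewrite E3, Es. ring. }
  set (B := 1 - Cmod x ^ 2) in *.
  assert (EB : RtoC B = (1 - x * Cconj x)%C) by (unfold B; rewrite RtoC_minus, RtoC_Cmod2; reflexivity).
  assert (NB : RtoC B <> 0%C) by (intros E; apply RtoC_inj in E; lra).
  set (y := (s / B)%C).
  assert (Es : s = (B * y)%C) by (unfold y; field; exact NB).
  exists x, y. repeat split; [exact Hx | | exact E2 | fold B; rewrite E3, Es; ring].
  assert (Py := Cmod_ge_0 y). apply Hsq; [exact Py |].
  (* This vector is mapped to (c1, x + c1 conj(x) y, y). The cross terms of the two middle entries
     agree, and what remains is A B (1 - |y|^2) >= 0. *)
  specialize (H 1%C (Cconj x * y + Cconj c1 * x)%C (Cconj c1 * y)%C).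
  replace (c1 * (Cconj x * y + Cconj c1 * x) + c2 * 1)%C with (x + c1 * Cconj x * y)%C in H
    by (rewrite E2, EA; ring).
  replace (c1 * (Cconj c1 * y) + c2 * (Cconj x * y + Cconj c1 * x) + c3 * 1)%C with y in H
    by (rewrite E3, Es, E2, EA, EB; ring).
  rewrite Cmult_1_r, (Cmod_mult (Cconj c1) y), Cmod_1, Cmod_conj, Rpow_mult_distr in H.
  assert (K : Cmod (x + c1 * Cconj x * y) ^ 2 - Cmod (Cconj x * y + Cconj c1 * x) ^ 2
              = A * (Cmod x ^ 2 - Cmod x ^ 2 * Cmod y ^ 2)).
  { unfold A. rewrite !Cmod2_alt. clear. destruct x, y, c1. simpl. ring. }
  assert (K2 : 0 <= (A * B) * (1 - Cmod y ^ 2)) by (unfold A, B in *; nra).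
  assert (0 < A * B) by now apply Rmult_lt_0_compat.
  nra.
Qed.

Lemma schur_functional_bound (c1 c2 c3 x y : C) : Cmod c1 <= 1 -> Cmod x <= 1 -> Cmod y <= 1 ->
  c2 = ((1 - Cmod c1 ^ 2)%R * x)%C ->
  c3 = ((1 - Cmod c1 ^ 2)%R * (- Cconj c1 * x ^ 2 + (1 - Cmod x ^ 2)%R * y))%C ->
  Cmod (48 * c1 * c3 - 4 * c1 ^ 2 * c2 - 36 * c2 ^ 2 + 3 * c1 ^ 4) <= 36.
Proof.
  intros Hc Hx Hy E2 E3.
  set (r := Cmod c1) in *. set (t := Cmod x) in *.
  set (A := 1 - r ^ 2) in *.
  assert (Hr : 0 <= r) by apply Cmod_ge_0. assert (Ht : 0 <= t) by apply Cmod_ge_0.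
  assert (HA : 0 <= A) by (unfold A; nra).
  assert (HB : 0 <= 1 - t ^ 2) by nra.
  (* The x^2 terms of c1 c3 and c2^2 are merged before taking moduli: 48 r^2 + 36 A = 36 + 12
     r^2. *)
  replace (48 * c1 * c3 - 4 * c1 ^ 2 * c2 - 36 * c2 ^ 2 + 3 * c1 ^ 4)%C with
    (3%R * c1 ^ 4 + (- 4)%R * (A * (c1 ^ 2 * x)) + (- (A * (36 + 12 * r ^ 2)))%R * x ^ 2
      + (48 * A * (1 - t ^ 2))%R * (c1 * y))%C.
  2: { rewrite E2, E3. unfold A.
       assert (Er : RtoC (r ^ 2) = (c1 * Cconj c1)%C) by apply RtoC_Cmod2.
       rewrite ?RtoC_opp, ?RtoC_mult, ?RtoC_plus, ?RtoC_minus, ?RtoC_mult, Er. ring. }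
  eapply Rle_trans; [apply Cmod_triangle |].
  eapply Rle_trans; [apply Rplus_le_compat_r, Cmod_triangle |].
  eapply Rle_trans; [apply Rplus_le_compat_r, Rplus_le_compat_r, Cmod_triangle |].
  rewrite !Cmod_mult, !Cmod_pow, !Cmod_R. fold r t.
  rewrite (Rabs_Ropp (A * _)), (Rabs_right A), (Rabs_right 3), (Rabs_left (- 4)), (Rabs_right (A * _)),
    (Rabs_right (48 * A * _)) by nra.
  assert (B1 : 48 * A * (1 - t ^ 2) * (r * Cmod y) <= 48 * A * (1 - t ^ 2) * r).
  { apply Rmult_le_compat_l; [nra |]. assert (0 <= Cmod y) by apply Cmod_ge_0. nra. }
  (* The coefficient of t^2 is 12 (1 - r) (3 - r) >= 0, so t = 1 is the worst case. *)
  assert (B2 : 4 * r ^ 2 * t + (36 + 12 * r ^ 2) * t ^ 2 + 48 * (1 - t ^ 2) * r <= 36 + 16 * r ^ 2).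
  { assert (0 <= (1 - r) * (3 - r) * (1 - t ^ 2)) by (apply Rmult_le_pos; nra).
    assert (0 <= r ^ 2 * (1 - t)) by (apply Rmult_le_pos; nra). nra. }
  assert (B3 := Rmult_le_compat_l A _ _ HA B2).
  assert (B4 : 0 <= r ^ 2) by nra. assert (B5 : 0 <= r ^ 4) by (apply pow_le; lra).
  unfold A in *. nra.
Qed.

(** * Complex power series *)

Definition is_Cser (x : nat -> C) (l : C) : Prop :=
  is_series (fun n => fst (x n)) (fst l) /\ is_series (fun n => snd (x n)) (snd l).

Definition PS (a : nat -> C) (z : C) : C :=
  (Series (fun n => fst (a n * z ^ n)%C), Series (fun n => snd (a n * z ^ n)%C)).

Lemma is_pseries_Cser (a : nat -> C) (z l : C) :
  is_pseries (K := C_AbsRing) (V := C_NormedModule) a z l <-> is_Cser (fun n => a n * z ^ n)%C l.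
Proof.
  assert (E : forall n, (scal (pow_n (K := C_AbsRing) z n) (a n) : C) = (a n * z ^ n)%C).
  { intros n. change ((pow_n (K := C_AbsRing) z n * a n)%C = (a n * z ^ n)%C).
    rewrite Cmult_comm. reflexivity. }
  set (s := sum_n (G := C_AbelianMonoid) (fun k => (a k * z ^ k)%C)).
  assert (S1 : forall n, fst (s n) = sum_n (fun k => fst (a k * z ^ k)%C) n).
  { unfold s. induction n as [| n IH]; [now rewrite !sum_O |]. rewrite !sum_Sn, <- IH. reflexivity. }
  assert (S2 : forall n, snd (s n) = sum_n (fun k => snd (a k * z ^ k)%C) n).
  { unfold s. induction n as [| n IH]; [now rewrite !sum_O |]. rewrite !sum_Sn, <- IH. reflexivity. }
  assert (H0 : is_pseries (K := C_AbsRing) (V := C_NormedModule) a z l <->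
               filterlim s eventually (locally (T := C_UniformSpace) l)).
  { split; intros H; (eapply filterlim_ext; [| exact H]); intros n; unfold s;
      apply sum_n_ext; intros k; [| symmetry]; apply E. }
  rewrite H0. unfold is_Cser, is_series. split.
  - intros H. split.
    + eapply filterlim_ext; [exact S1 |].
      eapply filterlim_comp; [exact H |]. apply continuous_fst.
    + eapply filterlim_ext; [exact S2 |].
      eapply filterlim_comp; [exact H |]. apply continuous_snd.
  - intros [H1 H2] P [e He].
    assert (F1 := H1 _ (locally_ball _ e)). assert (F2 := H2 _ (locally_ball _ e)).
    unfold filtermap in F1, F2 |- *. generalize (filter_and _ _ F1 F2).
    apply filter_imp. intros n [B1 B2].
    apply He. split; [rewrite S1 | rewrite S2]; assumption.
Qed.

Lemma is_Cser_unique (x : nat -> C) (l m : C) : is_Cser x l -> is_Cser x m -> l = m.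
Proof.
  intros [H1 H2] [H3 H4].
  apply is_series_unique in H1, H2, H3, H4. destruct l, m; simpl in *. congruence.
Qed.

Lemma is_Cser_ext (x y : nat -> C) (l : C) : (forall n, x n = y n) -> is_Cser x l -> is_Cser y l.
Proof.
  intros E [H1 H2]. split; (eapply is_series_ext; [| eassumption]); intros n; cbv beta; now rewrite E.
Qed.

Lemma is_Cser_minus (x y : nat -> C) (l m : C) :
  is_Cser x l -> is_Cser y m -> is_Cser (fun n => x n - y n)%C (l - m).
Proof. intros [H1 H2] [H3 H4]. split; now apply (is_series_minus (V := R_NormedModule)). Qed.

Lemma is_Cser_scal (c : C) (x : nat -> C) (l : C) :
  is_Cser x l -> is_Cser (fun n => c * x n)%C (c * l).
Proof.
  intros [H1 H2]. split; simpl.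
  - apply (is_series_minus (V := R_NormedModule)); now apply (is_series_scal (V := R_NormedModule)).
  - apply (is_series_plus (V := R_NormedModule)); now apply (is_series_scal (V := R_NormedModule)).
Qed.

Lemma is_Cser_shift (x : nat -> C) (l : C) :
  is_Cser (fun n => x (S n)) l -> is_Cser x (x 0%nat + l).
Proof.
  intros [H1 H2]. split; apply (is_series_decr_1 (V := R_NormedModule)).
  - replace (plus _ _) with (fst l); [exact H1 |]. unfold plus, opp; simpl. ring.
  - replace (plus _ _) with (snd l); [exact H2 |]. unfold plus, opp; simpl. ring.
Qed.

Lemma ex_Cser (x : nat -> C) (b : nat -> R) :
  (forall n, Cmod (x n) <= b n) -> ex_series b ->
  is_Cser x (Series (fun n => fst (x n)), Series (fun n => snd (x n))).
Proof.
  intros Hb Hs. split; apply Series_correct;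
    apply (@ex_series_le R_AbsRing R_CompleteNormedModule _ b); try exact Hs;
    intros n; (eapply Rle_trans; [| apply (Hb n)]).
  - apply Rabs_fst_le.
  - apply Rabs_snd_le.
Qed.

Lemma is_Cser_bound (x : nat -> C) (b : nat -> R) (l : C) :
  (forall n, Cmod (x n) <= b n) -> ex_series b -> is_Cser x l -> Cmod l <= 2 * Series b.
Proof.
  intros Hb Hs H. assert (H' := is_Cser_unique _ _ _ H (ex_Cser _ _ Hb Hs)). subst l.
  eapply Rle_trans; [apply Cmod_le_Rabs |]. cbn [fst snd].
  assert (B : forall u : nat -> R, (forall n, Rabs (u n) <= Cmod (x n)) -> Rabs (Series u) <= Series b).
  { intros u Hu. eapply Rle_trans.
    - apply Series_Rabs. apply (@ex_series_le R_AbsRing R_CompleteNormedModule _ b); [| exact Hs].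
      intros n. change (Rabs (Rabs (u n)) <= b n). rewrite Rabs_Rabsolu. eauto using Rle_trans.
    - apply Series_le; [| exact Hs]. intros n. split; [apply Rabs_pos | eauto using Rle_trans]. }
  assert (B1 := B (fun n => fst (x n)) (fun n => Rabs_fst_le (x n))).
  assert (B2 := B (fun n => snd (x n)) (fun n => Rabs_snd_le (x n))).
  lra.
Qed.

(** Abel's condition: it gives absolute convergence for |z| < rho, and is stable under shifts and,
    on a smaller radius, under differentiation. *)
Definition geom_bounded (a : nat -> C) (rho : R) : Prop :=
  exists M, forall n, Cmod (a n) * rho ^ n <= M.

Lemma PS_term_bound (a : nat -> C) (rho M : R) (z : C) (n : nat) :
  0 < rho -> Cmod (a n) * rho ^ n <= M -> Cmod (a n * z ^ n) <= M * (Cmod z / rho) ^ n.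
Proof.
  intros Hr H. rewrite Cmod_mult, Cmod_pow.
  unfold Rdiv. rewrite Rpow_mult_distr, pow_inv.
  assert (P : 0 < rho ^ n) by now apply pow_lt.
  replace (Cmod (a n) * Cmod z ^ n) with (Cmod (a n) * rho ^ n * (Cmod z ^ n * / rho ^ n)) by (field; lra).
  apply Rmult_le_compat_r; [| exact H].
  apply Rmult_le_pos; [apply pow_le, Cmod_ge_0 | apply Rlt_le, Rinv_0_lt_compat, P].
Qed.

Lemma ratio_lt_1 (rho : R) (z : C) : 0 < rho -> Cmod z < rho -> Rabs (Cmod z / rho) < 1.
Proof.
  intros Hr Hz. rewrite Rabs_right.
  - apply Rlt_div_l; lra.
  - apply Rle_ge, Rdiv_le_0_compat; [apply Cmod_ge_0 | exact Hr].
Qed.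

Lemma PS_correct (a : nat -> C) (rho : R) (z : C) :
  geom_bounded a rho -> Cmod z < rho -> is_Cser (fun n => a n * z ^ n)%C (PS a z).
Proof.
  intros [M HM] Hz. assert (Hr : 0 < rho) by (pose proof (Cmod_ge_0 z); lra).
  apply ex_Cser with (b := fun n => M * (Cmod z / rho) ^ n).
  - intros n. now apply PS_term_bound.
  - apply (ex_series_scal (V := R_NormedModule)), ex_series_geom. now apply ratio_lt_1.
Qed.

Lemma PS_unique (a : nat -> C) (z l : C) : is_Cser (fun n => a n * z ^ n)%C l -> PS a z = l.
Proof.
  intros [H1 H2]. unfold PS. rewrite (is_series_unique _ _ H1), (is_series_unique _ _ H2). now destruct l.
Qed.

Lemma geom_bounded_S (a : nat -> C) (rho : R) :
  0 < rho -> geom_bounded a rho -> geom_bounded (fun n => a (S n)) rho.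
Proof.
  intros Hr [M HM]. exists (M / rho). intros n. specialize (HM (S n)). simpl in HM.
  apply (proj1 (Rle_div_r (Cmod (a (S n)) * rho ^ n) M rho Hr)). lra.
Qed.

Lemma PS_shift (a : nat -> C) (rho : R) (z : C) : geom_bounded a rho -> Cmod z < rho ->
  PS a z = (a 0%nat + z * PS (fun n => a (S n)) z)%C.
Proof.
  intros Ha Hz. assert (Hr : 0 < rho) by (pose proof (Cmod_ge_0 z); lra).
  apply PS_unique.
  replace (a 0%nat) with (a 0%nat * z ^ 0)%C by (simpl; ring).
  apply (is_Cser_shift (fun n => a n * z ^ n)%C).
  eapply is_Cser_ext; [| apply is_Cser_scal, (PS_correct _ rho); [now apply geom_bounded_S | exact Hz]].
  intros n. simpl. ring.
Qed.

Lemma is_Cser_0 : is_Cser (fun _ => RtoC 0) 0.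
Proof.
  split; unfold is_series; simpl; (apply filterlim_ext with (f := fun _ : nat => 0); [| apply filterlim_const]);
    intros n; rewrite sum_n_const; ring.
Qed.

Lemma PS_0 (a : nat -> C) : PS a 0 = a 0%nat.
Proof.
  apply PS_unique.
  replace (a 0%nat) with (a 0%nat * 0 ^ 0 + 0)%C by (simpl; ring).
  apply (is_Cser_shift (fun n => a n * 0 ^ n)%C).
  eapply is_Cser_ext; [| exact is_Cser_0]. intros n. simpl. ring.
Qed.

Lemma PS_bound (a : nat -> C) (rho : R) : 0 < rho -> geom_bounded a rho ->
  exists M, 0 <= M /\ forall z, Cmod z <= rho / 2 -> Cmod (PS a z) <= M.
Proof.
  intros Hr [M HM].
  assert (HM0 : 0 <= M).
  { eapply Rle_trans; [| apply (HM 0%nat)]. simpl. rewrite Rmult_1_r. apply Cmod_ge_0. }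
  assert (G : Rabs (1 / 2) < 1) by (rewrite Rabs_right; lra).
  exists (2 * Series (fun n => M * (1 / 2) ^ n)). split.
  - rewrite Series_scal_l, Series_geom by exact G. lra.
  - intros z Hz. eapply is_Cser_bound; [| | apply (PS_correct a rho); [now exists M | lra]].
    + intros n. eapply Rle_trans; [exact (PS_term_bound a rho M z n Hr (HM n)) |].
      apply Rmult_le_compat_l; [exact HM0 |]. apply pow_incr. split.
      * apply Rdiv_le_0_compat; [apply Cmod_ge_0 | exact Hr].
      * apply Rle_div_l; lra.
    + apply (ex_series_scal (V := R_NormedModule)), ex_series_geom, G.
Qed.

Lemma PS_taylor3 (a : nat -> C) (rho : R) : 0 < rho -> geom_bounded a rho ->
  exists M, 0 <= M /\ forall z, Cmod z <= rho / 2 -> Cmod (PS a z - poly3 a z) <= M * Cmod z ^ 4.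
Proof.
  intros Hr H0.
  assert (H1 := geom_bounded_S _ _ Hr H0). assert (H2 := geom_bounded_S _ _ Hr H1).
  assert (H3 := geom_bounded_S _ _ Hr H2). assert (H4 := geom_bounded_S _ _ Hr H3).
  destruct (PS_bound _ _ Hr H4) as (M & HM & HB). exists M; split; [exact HM |].
  intros z Hz. assert (Hz' : Cmod z < rho) by lra.
  rewrite (PS_shift _ _ _ H0 Hz'), (PS_shift _ _ _ H1 Hz'), (PS_shift _ _ _ H2 Hz'), (PS_shift _ _ _ H3 Hz').
  set (T := PS _ z).
  replace (_ - _)%C with (T * z ^ 4)%C by (unfold poly3; ring).
  rewrite Cmod_mult, Cmod_pow. apply Rmult_le_compat_r; [apply pow_le, Cmod_ge_0 | now apply HB].
Qed.

(** For s = 1 - (1 - q)/3 one has q <= s^3, so n^2 q^n <= (n s^n)^2 s^n, and n s^n <= 1 / (1 - s).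
    The factor n^2 comes from second-order remainders of powers. *)
Lemma n2_geom (q : R) : 0 < q < 1 ->
  exists s K, 0 < s < 1 /\ 0 <= K /\ forall n, INR n ^ 2 * q ^ n <= K * s ^ n.
Proof.
  intros Hq. set (s := 1 - (1 - q) / 3). assert (Hs : 0 < s < 1) by (unfold s; lra).
  assert (Hqs : q <= s ^ 3).
  { unfold s. set (u := (1 - q) / 3). replace q with (1 - 3 * u) by (unfold u; field).
    assert (0 <= u <= 1) by (unfold u; lra). assert (0 <= u * u * (3 - u)) by (apply Rmult_le_pos; nra).
    replace ((1 - u) ^ 3) with (1 - 3 * u + u * u * (3 - u)) by ring. lra. }
  assert (B : forall n, INR n * (1 - s) * s ^ n <= 1).
  { intros n. assert (D : INR n * (1 - s) * s ^ n <= 1 - s ^ n).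
    { induction n as [| n IH]; [simpl; lra |]. rewrite S_INR, <- !tech_pow_Rmult.
      assert (P : 0 <= s ^ n) by (apply pow_le; lra).
      assert (Q : s * (INR n * (1 - s) * s ^ n) <= s * (1 - s ^ n)) by (apply Rmult_le_compat_l; lra).
      assert (s * ((1 - s) * s ^ n) <= (1 - s) * 1).
      { assert (L : s ^ n <= 1) by (rewrite <- (pow1 n); apply pow_incr; lra).
        replace (s * ((1 - s) * s ^ n)) with ((1 - s) * (s * s ^ n)) by ring.
        apply Rmult_le_compat_l; [lra |]. rewrite <- (Rmult_1_r 1). apply Rmult_le_compat; lra. }
      lra. }
    assert (0 <= s ^ n) by (apply pow_le; lra). lra. }
  exists s, ((/ (1 - s)) ^ 2). split; [exact Hs |]. split; [apply pow2_ge_0 |]. intros n.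
  assert (P : 0 <= s ^ n) by (apply pow_le; lra).
  assert (N := pos_INR n).
  apply Rle_trans with (INR n ^ 2 * (s ^ 3) ^ n).
  - apply Rmult_le_compat_l; [nra |]. apply pow_incr. lra.
  - rewrite <- pow_mult, Nat.mul_comm, pow_mult.
    assert (E : INR n * s ^ n <= / (1 - s)).
    { apply (Rmult_le_reg_r (1 - s)); [lra |]. rewrite Rinv_l by lra. specialize (B n). lra. }
    replace (INR n ^ 2 * (s ^ n) ^ 3) with ((INR n * s ^ n) ^ 2 * s ^ n) by ring.
    apply Rmult_le_compat_r; [exact P |]. apply pow_incr. split; [now apply Rmult_le_pos | exact E].
Qed.

Definition PS_deriv (a : nat -> C) (n : nat) : C := (INR (S n) * a (S n))%C.

Lemma geom_bounded_deriv (a : nat -> C) (rho rho' : R) :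
  0 < rho' < rho -> geom_bounded a rho -> geom_bounded (PS_deriv a) rho'.
Proof.
  intros Hr [M HM].
  assert (HM0 : 0 <= M).
  { eapply Rle_trans; [| apply (HM 0%nat)]. simpl. rewrite Rmult_1_r. apply Cmod_ge_0. }
  set (q := rho' / rho).
  assert (Hq : 0 < q < 1) by (split; [apply Rdiv_lt_0_compat | apply Rlt_div_l]; lra).
  destruct (n2_geom q Hq) as (s & K & Hs & HK & HB).
  exists (M * K / rho'). intros n. unfold PS_deriv.
  rewrite Cmod_mult, Cmod_R, Rabs_right by (apply Rle_ge, pos_INR).
  apply (proj1 (Rle_div_r (INR (S n) * Cmod (a (S n)) * rho' ^ n) (M * K) rho' (proj1 Hr))).
  assert (E : rho' ^ S n = rho ^ S n * q ^ S n).
  { rewrite <- Rpow_mult_distr. f_equal. unfold q. field. lra. }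
  replace (INR (S n) * Cmod (a (S n)) * rho' ^ n * rho')
    with (Cmod (a (S n)) * rho ^ S n * (INR (S n) * q ^ S n)).
  2: { transitivity (INR (S n) * Cmod (a (S n)) * rho' ^ S n); [rewrite E; ring | simpl; ring]. }
  assert (P : 0 <= q ^ S n) by (apply pow_le; lra).
  assert (N1 : 1 <= INR (S n)) by (rewrite S_INR; pose proof (pos_INR n); lra).
  apply Rmult_le_compat; [apply Rmult_le_pos; [apply Cmod_ge_0 | apply pow_le; lra] | | apply HM |].
  - apply Rmult_le_pos; lra.
  - specialize (HB (S n)). assert (s ^ S n <= 1) by (rewrite <- (pow1 (S n)); apply pow_incr; lra).
    apply Rle_trans with (INR (S n) ^ 2 * q ^ S n); [apply Rmult_le_compat_r; nra |]. nra.
Qed.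

(** The remainders satisfy D_(n+1) = (z + h) D_n + h^2 n z^(n-1), whence the induction. The factor
    [R0 ^ 2] on the left avoids the exponent n - 2. *)
Lemma pow_second_difference (z h : C) (R0 : R) (n : nat) : 0 < R0 -> Cmod z <= R0 -> Cmod (z + h) <= R0 ->
  Cmod ((z + h) ^ n - z ^ n - h * (INR n * z ^ pred n)) * R0 ^ 2 <= Cmod h ^ 2 * (INR n ^ 2 * R0 ^ n).
Proof.
  intros HR Hz Hzh. assert (Hh := Cmod_ge_0 h). induction n as [| n IH].
  - simpl. replace (1 - 1 - h * (0 * 1))%C with (RtoC 0) by ring. rewrite Cmod_0. lra.
  - replace ((z + h) ^ S n - z ^ S n - h * (INR (S n) * z ^ pred (S n)))%C
      with ((z + h) * ((z + h) ^ n - z ^ n - h * (INR n * z ^ pred n)) + h * h * (INR n * z ^ pred n))%C.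
    2: { destruct n as [| n]; [simpl; ring |]. rewrite (S_INR (S n)), RtoC_plus. cbn [pred].
         rewrite !Cpow_S. ring. }
    set (D := ((z + h) ^ n - z ^ n - h * (INR n * z ^ pred n))%C) in *.
    assert (PR := pow_lt R0 n HR). assert (N := pos_INR n).
    assert (B : Cmod (INR n * z ^ pred n) * R0 <= INR n * R0 ^ n).
    { rewrite Cmod_mult, Cmod_R, Rabs_right, Cmod_pow by lra. destruct n as [| n]; [simpl; lra |].
      cbn [pred]. rewrite Rmult_assoc. apply Rmult_le_compat_l; [exact N |].
      rewrite <- tech_pow_Rmult, Rmult_comm. apply Rmult_le_compat_l; [lra |].
      apply pow_incr. split; [apply Cmod_ge_0 | exact Hz]. }
    apply Rle_trans with ((R0 * Cmod D + Cmod h ^ 2 * Cmod (INR n * z ^ pred n)) * R0 ^ 2).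
    { apply Rmult_le_compat_r; [nra |]. eapply Rle_trans; [apply Cmod_triangle |].
      rewrite !Cmod_mult. apply Rplus_le_compat.
      - apply Rmult_le_compat_r; [apply Cmod_ge_0 | exact Hzh].
      - apply Req_le. ring. }
    rewrite S_INR, <- (tech_pow_Rmult R0 n).
    assert (B1 := Rmult_le_compat_l R0 _ _ (Rlt_le _ _ HR) IH).
    assert (B2 : Cmod h ^ 2 * R0 * (Cmod (INR n * z ^ pred n) * R0) <= Cmod h ^ 2 * R0 * (INR n * R0 ^ n)).
    { apply Rmult_le_compat_l; [| exact B]. apply Rmult_le_pos; [apply pow2_ge_0 | lra]. }
    assert (B3 : 0 <= Cmod h ^ 2 * R0 * ((INR n + 1) * R0 ^ n)).
    { repeat apply Rmult_le_pos; lra. }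
    nra.
Qed.

(** Termwise differentiation: on a radius [R0] strictly between |z| and rho, the second-order
    remainders sum to a constant times |h|^2. *)
Lemma Cder_PS (a : nat -> C) (rho : R) (z : C) :
  geom_bounded a rho -> Cmod z < rho -> Cder (PS a) z (PS (PS_deriv a) z).
Proof.
  intros [M HM] Hz. assert (Hz0 := Cmod_ge_0 z).
  assert (HM0 : 0 <= M).
  { eapply Rle_trans; [| apply (HM 0%nat)]. simpl. rewrite Rmult_1_r. apply Cmod_ge_0. }
  set (R0 := (Cmod z + rho) / 2). assert (HR : 0 < R0 < rho) by (unfold R0; lra).
  set (q := R0 / rho).
  assert (Hq : 0 < q < 1) by (split; [apply Rdiv_lt_0_compat | apply Rlt_div_l]; lra).
  destruct (n2_geom q Hq) as (s & K & Hs & HK & HB).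
  set (b := fun n => M / R0 ^ 2 * (K * s ^ n)).
  assert (Eb : ex_series b).
  { apply (ex_series_scal (V := R_NormedModule)), (ex_series_scal (V := R_NormedModule)), ex_series_geom.
    rewrite Rabs_right; lra. }
  assert (HR2 : 0 < R0 ^ 2) by (apply pow_lt; lra).
  assert (Pb : forall n, 0 <= b n).
  { intros n. unfold b. apply Rmult_le_pos; [apply Rdiv_le_0_compat; lra |].
    apply Rmult_le_pos; [lra | apply pow_le; lra]. }
  set (B := 2 * Series b).
  assert (HB0 : 0 <= B).
  { rewrite <- Cmod_0. apply (is_Cser_bound (fun _ => RtoC 0) b).
    - intros n. rewrite Cmod_0. apply Pb.
    - exact Eb.
    - exact is_Cser_0. }
  intros eps He.
  exists (Rmin (R0 - Cmod z) (eps / (B + 1))). split.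
  { apply Rmin_glb_lt; [unfold R0; lra | apply Rdiv_lt_0_compat; lra]. }
  intros h Hh. apply Rmin_Rgt_l in Hh as [Hh1 Hh2]. assert (Hh0 := Cmod_ge_0 h).
  assert (Hzh : Cmod (z + h) <= R0) by (eapply Rle_trans; [apply Cmod_triangle | lra]).
  assert (Ha : geom_bounded a rho) by (now exists M).
  assert (S1 := PS_correct a rho (z + h) Ha ltac:(lra)).
  assert (S2 := PS_correct a rho z Ha Hz).
  assert (S3 : is_Cser (fun n => INR n * a n * z ^ pred n)%C (PS (PS_deriv a) z)).
  (* Adding the null term of index 0 aligns the derived series with the two others. *)
  { replace (PS (PS_deriv a) z) with (INR 0 * a 0%nat * z ^ pred 0 + PS (PS_deriv a) z)%C by (simpl; ring).
    apply (is_Cser_shift (fun n => INR n * a n * z ^ pred n)%C).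
    apply (PS_correct (PS_deriv a) R0); [| unfold R0; lra].
    apply geom_bounded_deriv with rho; [exact HR | exact Ha]. }
  assert (S4 := is_Cser_minus _ _ _ _ (is_Cser_minus _ _ _ _ S1 S2) (is_Cser_scal h _ _ S3)).
  assert (Bd : Cmod (PS a (z + h) - PS a z - h * PS (PS_deriv a) z)
               <= 2 * Series (fun n => Cmod h ^ 2 * b n)).
  { eapply is_Cser_bound; [| | exact S4]; [| now apply (ex_series_scal (V := R_NormedModule))].
    intros n. cbv beta.
    replace (a n * (z + h) ^ n - a n * z ^ n - h * (INR n * a n * z ^ pred n))%C
      with (a n * ((z + h) ^ n - z ^ n - h * (INR n * z ^ pred n)))%C by ring.
    rewrite Cmod_mult.
    assert (W := pow_second_difference z h R0 n ltac:(lra) ltac:(unfold R0; lra) Hzh).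
    set (D := Cmod (_ - _ - _)) in *.
    assert (PR := pow_lt rho n ltac:(lra)).
    assert (E : R0 ^ n = rho ^ n * q ^ n).
    { rewrite <- Rpow_mult_distr. f_equal. unfold q. field. lra. }
    apply (Rmult_le_reg_r (R0 ^ 2)); [exact HR2 |].
    apply Rle_trans with (Cmod (a n) * (Cmod h ^ 2 * (INR n ^ 2 * R0 ^ n))).
    { rewrite Rmult_assoc. apply Rmult_le_compat_l; [apply Cmod_ge_0 | exact W]. }
    rewrite E.
    replace (Cmod (a n) * (Cmod h ^ 2 * (INR n ^ 2 * (rho ^ n * q ^ n))))
      with (Cmod h ^ 2 * ((Cmod (a n) * rho ^ n) * (INR n ^ 2 * q ^ n))) by ring.
    unfold b. replace (Cmod h ^ 2 * (M / R0 ^ 2 * (K * s ^ n)) * R0 ^ 2)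
      with (Cmod h ^ 2 * (M * (K * s ^ n))) by (field; lra).
    apply Rmult_le_compat_l; [apply pow2_ge_0 |].
    apply Rmult_le_compat; [apply Rmult_le_pos; [apply Cmod_ge_0 | lra] | | apply HM | apply HB].
    apply Rmult_le_pos; [apply pow2_ge_0 | apply pow_le; lra]. }
  eapply Rle_trans; [exact Bd |].
  rewrite Series_scal_l. fold B.
  replace (2 * (Cmod h ^ 2 * Series b)) with (Cmod h * B * Cmod h) by (unfold B; ring).
  apply Rmult_le_compat_r; [exact Hh0 |].
  apply Rle_trans with (eps / (B + 1) * (B + 1)); [| apply Req_le; field; lra].
  apply Rmult_le_compat; lra.
Qed.

(** * Real coefficients: Cauchy products and Kaluza's theorem *)

Definition RPS (a : nat -> R) (z : C) : C := PS (fun n => RtoC (a n)) z.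

Definition conv (a b : nat -> R) (n : nat) : R := sum_f_R0 (fun k => a k * b (n - k)%nat) n.

Lemma geom_bounded_1 (a : nat -> R) : (forall n, Rabs (a n) <= 1) -> geom_bounded (fun n => RtoC (a n)) 1.
Proof. intros H. exists 1. intros n. rewrite Cmod_R, pow1, Rmult_1_r. apply H. Qed.

Lemma RPS_correct (a : nat -> R) (z : C) : (forall n, Rabs (a n) <= 1) -> Cmod z < 1 ->
  is_Cser (fun n => a n * z ^ n)%C (RPS a z).
Proof. intros Ha Hz. apply (PS_correct (fun n => RtoC (a n)) 1); [now apply geom_bounded_1 | exact Hz]. Qed.

Lemma RPS_ext (a b : nat -> R) (z : C) : (forall n, a n = b n) -> RPS a z = RPS b z.
Proof.
  intros H. unfold RPS, PS. f_equal; apply Series_ext; intros n; now rewrite H.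
Qed.

Lemma RPS_opp (a : nat -> R) (z : C) : (forall n, Rabs (a n) <= 1) -> Cmod z < 1 ->
  RPS (fun n => - a n) z = (- RPS a z)%C.
Proof.
  intros Ha Hz. apply PS_unique.
  replace (- RPS a z)%C with (- (1) * RPS a z)%C by ring.
  eapply is_Cser_ext; [| apply is_Cser_scal, RPS_correct; assumption].
  intros n. cbv beta. rewrite RtoC_opp. ring.
Qed.

Lemma sum_f_R0_minus (u v : nat -> R) (n : nat) :
  sum_f_R0 (fun k => u k - v k) n = sum_f_R0 u n - sum_f_R0 v n.
Proof. induction n as [| n IH]; simpl; [ring | rewrite IH; ring]. Qed.

(** Four real Cauchy products of the absolutely convergent component series, recombined into real
    and imaginary parts. *)
Lemma RPS_mult (a b : nat -> R) (z : C) :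
  (forall n, Rabs (a n) <= 1) -> (forall n, Rabs (b n) <= 1) -> Cmod z < 1 ->
  (RPS a z * RPS b z)%C = RPS (conv a b) z.
Proof.
  intros Ha Hb Hz. symmetry. apply PS_unique.
  destruct (RPS_correct a z Ha Hz) as [A1 A2], (RPS_correct b z Hb Hz) as [B1 B2].
  assert (Abs : forall c : nat -> R, (forall n, Rabs (c n) <= 1) ->
    ex_series (fun n => Rabs (fst (c n * z ^ n)%C)) /\ ex_series (fun n => Rabs (snd (c n * z ^ n)%C))).
  { intros c Hc.
    assert (G : ex_series (fun n => Cmod z ^ n)).
    { apply ex_series_geom. rewrite Rabs_right; [exact Hz | apply Rle_ge, Cmod_ge_0]. }
    assert (Bd : forall n, Cmod (c n * z ^ n) <= Cmod z ^ n).
    { intros n. rewrite Cmod_mult, Cmod_R, Cmod_pow. rewrite <- (Rmult_1_l (Cmod z ^ n)) at 2.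
      apply Rmult_le_compat_r; [apply pow_le, Cmod_ge_0 | apply Hc]. }
    split; apply (@ex_series_le R_AbsRing R_CompleteNormedModule _ (fun n => Cmod z ^ n));
      try exact G; intros n; (eapply Rle_trans; [| apply (Bd n)]).
    - change (Rabs (Rabs (fst (c n * z ^ n)%C)) <= Cmod (c n * z ^ n)).
      rewrite Rabs_Rabsolu. apply Rabs_fst_le.
    - change (Rabs (Rabs (snd (c n * z ^ n)%C)) <= Cmod (c n * z ^ n)).
      rewrite Rabs_Rabsolu. apply Rabs_snd_le. }
  destruct (Abs a Ha) as [A3 A4], (Abs b Hb) as [B3 B4].
  assert (P11 := is_series_mult _ _ _ _ A1 B1 A3 B3).
  assert (P22 := is_series_mult _ _ _ _ A2 B2 A4 B4).
  assert (P12 := is_series_mult _ _ _ _ A1 B2 A3 B4).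
  assert (P21 := is_series_mult _ _ _ _ A2 B1 A4 B3).
  assert (Split : forall n k, (k <= n)%nat ->
    ((a k * b (n - k)%nat)%R * z ^ n)%C = ((a k * z ^ k) * (b (n - k)%nat * z ^ (n - k)))%C).
  { intros n k Hk. rewrite RtoC_mult. replace (z ^ n)%C with (z ^ k * z ^ (n - k))%C; [ring |].
    rewrite <- Cpow_add_r. f_equal. lia. }
  split.
  - eapply is_series_ext; [| apply (is_series_minus (V := R_NormedModule) _ _ _ _ P11 P22)].
    intros n. change (sum_f_R0 (fun k => fst (a k * z ^ k)%C * fst (b (n - k)%nat * z ^ (n - k))%C) n
      - sum_f_R0 (fun k => snd (a k * z ^ k)%C * snd (b (n - k)%nat * z ^ (n - k))%C) n = fst (conv a b n * z ^ n)%C).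
    rewrite <- sum_f_R0_minus.
    transitivity (conv a b n * fst (z ^ n)%C); [| simpl; ring].
    unfold conv. rewrite Rmult_comm, scal_sum. apply sum_eq. intros k Hk.
    transitivity (fst ((a k * b (n - k)%nat)%R * z ^ n)%C); [| simpl; ring].
    rewrite Split by exact Hk. reflexivity.
  - eapply is_series_ext; [| apply (is_series_plus (V := R_NormedModule) _ _ _ _ P12 P21)].
    intros n. change (sum_f_R0 (fun k => fst (a k * z ^ k)%C * snd (b (n - k)%nat * z ^ (n - k))%C) n
      + sum_f_R0 (fun k => snd (a k * z ^ k)%C * fst (b (n - k)%nat * z ^ (n - k))%C) n = snd (conv a b n * z ^ n)%C).
    rewrite <- sum_plus.
    transitivity (conv a b n * snd (z ^ n)%C); [| simpl; ring].
    unfold conv. rewrite Rmult_comm, scal_sum. apply sum_eq. intros k Hk.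
    transitivity (snd ((a k * b (n - k)%nat)%R * z ^ n)%C); [| simpl; ring].
    rewrite Split by exact Hk. reflexivity.
Qed.

Lemma course_of_values_rec (F : nat -> (nat -> R) -> R) :
  (forall n a b, (forall k, (k < n)%nat -> a k = b k) -> F n a = F n b) ->
  exists a : nat -> R, forall n, a n = F n a.
Proof.
  intros HF.
  (* [T n] tabulates the values at indices below n, where the default 0 is never read. *)
  set (T := fix T n := match n with
    | O => fun _ => 0
    | S m => fun k => if Nat.eq_dec k m then F m (T m) else T m k end).
  exists (fun n => T (S n) n).
  assert (Stab : forall m k, (k < m)%nat -> T m k = T (S k) k).
  { induction m as [| m IH]; intros k Hk; [lia |]. simpl.
    destruct (Nat.eq_dec k m) as [-> | Hn].
    - destruct (Nat.eq_dec m m); [reflexivity | lia].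
    - rewrite IH by lia. simpl. reflexivity. }
  intros n. simpl. destruct (Nat.eq_dec n n) as [_ | h]; [| lia].
  apply HF. intros k Hk. rewrite Stab by exact Hk. reflexivity.
Qed.

Definition delta0 (n : nat) : R := match n with O => 1 | _ => 0 end.

(* Kaluza's theorem, for b_n = 1 / (n + 1): log-convexity of b makes the
   reciprocal series 1 - sum d_n z^n have 0 <= d_n <= b_n. *)
Lemma kaluza_reciprocal : exists g : nat -> R, (forall n, Rabs (g n) <= 1) /\
  forall n, conv g (fun k => / INR (S k)) n = delta0 n.
Proof.
  set (b := fun k => / INR (S k)).
  assert (b0 : b 0%nat = 1) by (unfold b; simpl; field).
  destruct (course_of_values_rec (fun n a => match n with
    | O => 1 | S m => - sum_f_R0 (fun k => a k * b (n - k)%nat) m end)) as [g Hg].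
  { intros [| n] a a' H; [reflexivity |]. f_equal. apply sum_eq. intros k Hk. rewrite H by lia. reflexivity. }
  assert (Hc : forall n, conv g b n = delta0 n).
  { intros [| n]; unfold conv; cbn [sum_f_R0].
    - rewrite Hg. change (1 * b 0%nat = 1). rewrite b0. apply Rmult_1_r.
    - rewrite (Hg (S n)), Nat.sub_diag, b0. simpl delta0. cbv beta iota. ring. }
  exists g. split; [| exact Hc].
  assert (Pb : forall n, 0 < b n) by (intros n; apply Rinv_0_lt_compat, lt_0_INR; lia).
  assert (b1 : forall n, b n <= 1).
  { intros n. unfold b. rewrite <- Rinv_1. apply Rinv_le_contravar; [lra |].
    rewrite S_INR. pose proof (pos_INR n). lra. }
  assert (g0 : g 0%nat = 1) by (rewrite Hg; reflexivity).
  assert (Sum : forall n, sum_f_R0 (fun k => - g (S k) * b (n - k)%nat) n = b (S n)).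
  { intros n. assert (E := Hc (S n)). unfold conv in E. rewrite decomp_sum in E by lia.
    simpl pred in E. rewrite g0, Nat.sub_0_r, Rmult_1_l in E. simpl delta0 in E.
    assert (X : sum_f_R0 (fun k => - g (S k) * b (n - k)%nat) n
                = (- 1) * sum_f_R0 (fun i => g (S i) * b (S n - S i)%nat) n).
    { rewrite scal_sum. apply sum_eq. intros k Hk.
      replace (S n - S k)%nat with (n - k)%nat by lia. ring. }
    lra. }
  assert (Hneg : forall n, 0 <= - g (S n)).
  { intros n. induction n as [n IH] using (well_founded_induction Wf_nat.lt_wf).
    destruct n as [| n].
    - assert (E := Sum 0%nat). change (- g 1%nat * b 0%nat = b 1%nat) in E. specialize (Pb 1%nat).
      rewrite b0 in E. lra.
    - assert (E := Sum (S n)). cbn [sum_f_R0] in E. rewrite Nat.sub_diag in E.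
      rewrite b0, Rmult_1_r in E.
      (* Log-convexity: b_(m+1) / b_m increases with m. Multiplying the identity of the preceding
         index by the largest ratio [r] therefore dominates all terms but the last, which is left
         nonnegative. *)
      assert (L : sum_f_R0 (fun k => - g (S k) * b (S n - k)%nat) n <= b (S (S n))).
      { set (r := b (S (S n)) / b (S n)).
        replace (b (S (S n))) with (r * b (S n)) by (unfold r; field; apply Rgt_not_eq, Pb).
        rewrite <- (Sum n), scal_sum. apply sum_Rle. intros k Hk.
        rewrite Rmult_assoc. apply Rmult_le_compat_l; [apply IH; lia |].
        unfold r, b. replace (S (S n - k)) with (S (S (n - k))) by lia.
        rewrite !S_INR, minus_INR by lia.
        assert (K0 := pos_INR k). assert (K1 : INR k <= INR n) by (now apply le_INR).
        set (N := INR n) in *. set (m := N - INR k) in *. assert (0 <= m <= N) by (unfold m; lra).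
        apply Rmult_le_reg_l with ((m + 1 + 1) * (m + 1) * (N + 1 + 1 + 1)).
        { repeat apply Rmult_lt_0_compat; lra. }
        replace ((m + 1 + 1) * (m + 1) * (N + 1 + 1 + 1) * / (m + 1 + 1))
          with ((m + 1) * (N + 1 + 1 + 1)) by (field; lra).
        match goal with |- _ <= ?X => replace X with ((m + 1 + 1) * (N + 1 + 1)) by (field; lra) end.
        lra. }
      lra. }
  intros [| n]; [rewrite g0, Rabs_right; lra |].
  rewrite Rabs_left1 by (specialize (Hneg n); lra).
  (* In a sum of nonnegative terms, the last one is at most the whole sum b_(n+1). *)
  apply Rle_trans with (b (S n)); [| apply b1].
  rewrite <- Sum. destruct n as [| n].
  - simpl. rewrite b0. lra.
  - cbn [sum_f_R0]. rewrite Nat.sub_diag, b0.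
    assert (0 <= sum_f_R0 (fun k => - g (S k) * b (S n - k)%nat) n).
    { apply cond_pos_sum. intros k. apply Rmult_le_pos; [apply Hneg | apply Rlt_le, Pb]. }
    lra.
Qed.

(** * The logarithm and the Gregory coefficients *)

(* Coefficients of log (1 + z) / z. *)
Definition log_coef (n : nat) : R := (-1) ^ n * / INR (S n).

Lemma Rabs_pow_m1 (n : nat) : Rabs ((-1) ^ n) = 1.
Proof. rewrite <- RPow_abs, Rabs_left by lra. replace (- (-1)) with 1 by ring. apply pow1. Qed.

Lemma log_coef_bound (n : nat) : Rabs (log_coef n) <= 1.
Proof.
  unfold log_coef. rewrite Rabs_mult, Rabs_pow_m1, Rmult_1_l.
  assert (P : 1 <= INR (S n)) by (rewrite S_INR; pose proof (pos_INR n); lra).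
  rewrite Rabs_right by (apply Rle_ge, Rlt_le, Rinv_0_lt_compat; lra).
  rewrite <- Rinv_1. apply Rinv_le_contravar; lra.
Qed.

Lemma RPS_delta0 (z : C) : Cmod z < 1 -> RPS delta0 z = 1%C.
Proof.
  intros Hz. unfold RPS. rewrite (PS_shift _ 1 z); [| apply geom_bounded_1 | exact Hz].
  - simpl. rewrite (PS_unique (fun _ => 0%C) z 0); [ring |].
    eapply is_Cser_ext; [| exact is_Cser_0]. intros n. cbv beta. ring.
  - intros [| n]; simpl; rewrite ?Rabs_R0, ?Rabs_R1; lra.
Qed.

Definition alternating (n : nat) : R := (-1) ^ n.

Lemma geometric_RPS (z : C) : Cmod z < 1 -> (RPS alternating z * (1 + z))%C = 1%C.
Proof.
  intros Hz.
  assert (B : forall n, Rabs (alternating n) <= 1).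
  { intros n. unfold alternating. rewrite Rabs_pow_m1. lra. }
  assert (E : RPS alternating z = (1 + z * - RPS alternating z)%C).
  { rewrite <- RPS_opp by assumption. unfold RPS at 1.
    rewrite (PS_shift _ 1 z); [| now apply geom_bounded_1 | exact Hz].
    change (RtoC (alternating 0)) with (RtoC 1). f_equal. f_equal.
    apply RPS_ext. intros n. unfold alternating. simpl. ring. }
  set (S := RPS _ z) in *.
  transitivity (S + z * S)%C; [ring |]. rewrite E at 1. ring.
Qed.

(** On a half-plane containing 1 + z for every z of the disk, the case distinction in [Carg]
    collapses to one differentiable expression. *)
Lemma Clog_right_half_plane (a b : R) : 0 < a ->
  Clog (a, b) = (ln (sqrt (a ^ 2 + b ^ 2)), atan (b / a)).
Proof.
  intros Ha. unfold Clog, Carg. simpl Re. simpl Im. f_equal.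
  assert (HM : Cmod (a, b) = sqrt (a ^ 2 + b ^ 2)) by reflexivity.
  set (m := Cmod (a, b)) in *.
  assert (Hm2 : m ^ 2 = a ^ 2 + b ^ 2) by (rewrite HM; apply pow2_sqrt; nra).
  assert (Hm : 0 < m) by (apply Cmod_gt_0; intros E; injection E; intros; lra).
  assert (Ham : 0 < a / m) by now apply Rdiv_lt_0_compat.
  assert (K : acos (a / m) = atan (Rabs b / a)).
  { rewrite acos_atan by exact Ham. f_equal.
    replace (1 - (a / m)²) with ((Rabs b / m)²).
    - rewrite sqrt_Rsqr; [field; lra |]. apply Rdiv_le_0_compat; [apply Rabs_pos | exact Hm].
    - rewrite !Rsqr_div', <- Rsqr_abs. unfold Rsqr.
      replace (b * b) with (m ^ 2 - a ^ 2) by (rewrite Hm2; ring). field. lra. }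
  destruct Rle_dec as [h | h]; rewrite K.
  - rewrite Rabs_right; lra.
  - rewrite Rabs_left by lra. rewrite <- atan_opp. f_equal. field. lra.
Qed.

(** Coefficients of log (1 + z) itself; the derived series is the geometric one. *)
Definition log_primitive (n : nat) : R := match n with O => 0 | S m => log_coef m end.

Lemma log_primitive_bound (n : nat) : Rabs (log_primitive n) <= 1.
Proof. destruct n; simpl; [rewrite Rabs_R0; lra | apply log_coef_bound]. Qed.

Lemma Cder_log_primitive (z : C) : Cmod z < 1 -> Cder (RPS log_primitive) z (/ (1 + z)).
Proof.
  intros Hz.
  assert (N : (1 + z)%C <> 0%C).
  { intros E. assert (Cmod z = 1); [| lra].
    replace z with (- (1))%C; [apply Cmod_m1 |]. rewrite <- (Cplus_0_r (- (1))), <- E. ring. }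
  replace (/ (1 + z))%C with (PS (PS_deriv (fun n => RtoC (log_primitive n))) z).
  { apply (Cder_PS _ 1); [apply geom_bounded_1, log_primitive_bound | exact Hz]. }
  transitivity (RPS alternating z).
  - unfold RPS. f_equal. apply functional_extensionality. intros n.
    unfold PS_deriv. simpl log_primitive. unfold log_coef, alternating. rewrite <- RtoC_mult. f_equal.
    field. apply not_0_INR. lia.
  - assert (E := geometric_RPS z Hz).
    transitivity (RPS alternating z * (1 + z) * / (1 + z))%C; [field; exact N |].
    rewrite E. ring.
Qed.

(** Along t z with t in [0, 1], both sides have derivative z / (1 + t z), and both vanish at t = 0.
    The principal branch is thus matched componentwise. *)
Lemma Clog_series (z : C) : Cmod z < 1 -> Clog (1 + z) = (z * RPS log_coef z)%C.
Proof.
  intros Hz.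
  transitivity (RPS log_primitive z).
  2: { unfold RPS at 1. rewrite (PS_shift _ 1 z);
         [| apply geom_bounded_1, log_primitive_bound | exact Hz].
       simpl. fold (RPS log_coef z). ring. }
  destruct z as [x y]. set (z := (x, y) : C) in *.
  assert (Hx : Rabs x < 1) by (eapply Rle_lt_trans; [apply (Rabs_fst_le z) | exact Hz]).
  apply Rabs_lt_between in Hx.
  assert (Pos : forall t, 0 <= t <= 1 -> 0 < 1 + t * x) by (intros t Ht; nra).
  assert (D : forall t, 0 <= t <= 1 ->
    is_derive (fun t : R => fst (RPS log_primitive (0 + t * z)%C)) t (fst (z * / (1 + (0 + t * z)))%C) /\
    is_derive (fun t : R => snd (RPS log_primitive (0 + t * z)%C)) t (snd (z * / (1 + (0 + t * z)))%C)).
  { intros t Ht. apply Cder_line, Cder_log_primitive.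
    rewrite Cplus_0_l, Cmod_mult, Cmod_R, Rabs_right by lra. pose proof (Cmod_ge_0 z). nra. }
  assert (S0 : RPS log_primitive (0 + 0 * z) = 0%C).
  { replace (0 + 0 * z)%C with (RtoC 0) by ring. unfold RPS. now rewrite PS_0. }
  assert (S1 : (0 + 1 * z)%C = z) by ring.
  replace (1 + z)%C with ((1 + 1 * x, 1 * y) : C) by (apply injective_projections; simpl; ring).
  rewrite Clog_right_half_plane by (apply Pos; lra).
  assert (E1 : ln (sqrt ((1 + 1 * x) ^ 2 + (1 * y) ^ 2)) - fst (RPS log_primitive (0 + 1 * z)%C)
             = ln (sqrt ((1 + 0 * x) ^ 2 + (0 * y) ^ 2)) - fst (RPS log_primitive (0 + 0 * z)%C)).
  { symmetry. apply (eq_is_derive (V := R_NormedModule) (fun t : R =>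
      ln (sqrt ((1 + t * x) ^ 2 + (t * y) ^ 2)) - fst (RPS log_primitive (0 + t * z)%C))); [| lra].
    intros t Ht. destruct (D t Ht) as [D1 _]. specialize (Pos t Ht).
    assert (Q : 0 < (1 + t * x) ^ 2 + (t * y) ^ 2) by nra.
    assert (D2 : is_derive (fun t : R => ln (sqrt ((1 + t * x) ^ 2 + (t * y) ^ 2))) t
      (fst (z * / (1 + (0 + t * z)))%C)).
    { auto_derive.
      - split; [exact Q | split; [now apply sqrt_lt_R0 | trivial]].
      - simpl fst. set (q := sqrt _).
        assert (Hq : q * q = (1 + t * x) ^ 2 + (t * y) ^ 2).
        { unfold q. rewrite <- (sqrt_def ((1 + t * x) ^ 2 + (t * y) ^ 2)) by lra.
          f_equal; f_equal; ring. }
        assert (Hq0 : 0 < q).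
        { unfold q. apply sqrt_lt_R0. replace (_ + _) with ((1 + t * x) ^ 2 + (t * y) ^ 2) by ring. exact Q. }
        match goal with |- ?L = _ => transitivity (((1 + t * x) * x + t * y * y) / (q * q)) end.
        + field. lra.
        + rewrite Hq. field. nra. }
    assert (Z := is_derive_minus _ _ _ _ _ D2 D1).
    match type of Z with is_derive _ _ ?l => replace l with (zero : R_NormedModule) in Z end; [exact Z |].
    symmetry. apply (minus_eq_zero (G := R_AbelianGroup)). }
  assert (E2 : atan (1 * y / (1 + 1 * x)) - snd (RPS log_primitive (0 + 1 * z)%C)
             = atan (0 * y / (1 + 0 * x)) - snd (RPS log_primitive (0 + 0 * z)%C)).
  { symmetry. apply (eq_is_derive (V := R_NormedModule) (fun t : R =>
      atan (t * y / (1 + t * x)) - snd (RPS log_primitive (0 + t * z)%C))); [| lra].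
    intros t Ht. destruct (D t Ht) as [_ D1]. specialize (Pos t Ht).
    assert (Q : 0 < (1 + t * x) ^ 2 + (t * y) ^ 2) by nra.
    assert (D2 : is_derive (fun t : R => atan (t * y / (1 + t * x))) t
      (snd (z * / (1 + (0 + t * z)))%C)).
    { auto_derive; [lra |]. simpl. field. repeat split; nra. }
    assert (Z := is_derive_minus _ _ _ _ _ D2 D1).
    match type of Z with is_derive _ _ ?l => replace l with (zero : R_NormedModule) in Z end; [exact Z |].
    symmetry. apply (minus_eq_zero (G := R_AbelianGroup)). }
  rewrite S0, S1 in E1, E2. generalize dependent (RPS log_primitive z). intros P E1 E2.
  change (fst (RtoC 0)) with 0 in E1. change (snd (RtoC 0)) with 0 in E2.
  replace ((1 + 0 * x) ^ 2 + (0 * y) ^ 2) with 1 in E1 by ring. rewrite sqrt_1, ln_1 in E1.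
  replace (0 * y / (1 + 0 * x)) with 0 in E2 by (field; lra). rewrite atan_0 in E2.
  apply injective_projections; cbn [fst snd]; lra.
Qed.

(** The substitution z -> -z turns log (1 + z) / z into Kaluza's series with coefficients 1 / (n +
    1). The product form of the last clause serves the upper bound, where [Psi] is removed by
    multiplication. *)
Lemma Psi_power_series : exists G : nat -> R,
  (forall n, Rabs (G n) <= 1) /\ G 0%nat = 1 /\ G 1%nat = 1 / 2 /\
  forall z, Cmod z < 1 -> Psi z = RPS G z /\ (Psi z * RPS log_coef z)%C = 1%C.
Proof.
  destruct kaluza_reciprocal as (g & Hg & Hc).
  set (G := fun n => (-1) ^ n * g n).
  assert (HG : forall n, Rabs (G n) <= 1).
  { intros n. unfold G. rewrite Rabs_mult, Rabs_pow_m1, Rmult_1_l. apply Hg. }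
  assert (HR : forall z, Cmod z < 1 -> (RPS G z * RPS log_coef z)%C = 1%C).
  { intros z Hz. rewrite RPS_mult by (auto using log_coef_bound).
    rewrite <- (RPS_delta0 z Hz). apply RPS_ext. intros n.
    transitivity ((-1) ^ n * conv g (fun k => / INR (S k)) n).
    - unfold conv. rewrite scal_sum. apply sum_eq. intros k Hk. unfold G, log_coef.
      replace ((-1) ^ n) with ((-1) ^ k * (-1) ^ (n - k)) by (rewrite <- pow_add; f_equal; lia). ring.
    - rewrite Hc. destruct n; simpl; ring. }
  assert (g0 : g 0%nat = 1) by (specialize (Hc 0%nat); unfold conv in Hc; simpl in Hc; lra).
  exists G. split; [exact HG |]. split; [unfold G; simpl; lra |]. split.
  { specialize (Hc 1%nat). unfold conv in Hc. simpl in Hc. unfold G. simpl. rewrite g0 in Hc. lra. }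
  intros z Hz.
  assert (E : Psi z = RPS G z); [| rewrite E; auto].
  unfold Psi. destruct (Ceq_dec z 0) as [-> | Hz0].
  - unfold RPS. rewrite PS_0. unfold G. simpl. f_equal. lra.
  - rewrite Clog_series by exact Hz.
    assert (HL : RPS log_coef z <> 0%C).
    { intros E0. specialize (HR z Hz). rewrite E0, Cmult_0_r in HR. apply RtoC_inj in HR. lra. }
    transitivity (RPS G z * RPS log_coef z / RPS log_coef z)%C; [rewrite HR by exact Hz |]; field; auto.
Qed.

(** * The bound *)

Lemma jet_ext_coef (f : C -> C) (p q : nat -> C) :
  (forall n, (n <= 3)%nat -> p n = q n) -> jet f p -> jet f q.
Proof.
  intros E (M & d & HM & Hd & H). exists M, d. repeat split; try assumption.
  intros z Hz. specialize (H z Hz). unfold poly3 in *. now rewrite <- !E by lia.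
Qed.

Lemma jet_close (f g : C -> C) (p : nat -> C) (M d : R) :
  0 <= M -> 0 < d -> (forall z, 0 < Cmod z < d -> Cmod (g z - f z) <= M * Cmod z ^ 4) ->
  jet f p -> jet g p.
Proof.
  intros HM Hd H (N & e & HN & He & Hf). exists (M + N), (Rmin d e).
  split; [lra |]. split; [now apply Rmin_glb_lt |]. intros z [Hz0 Hz].
  apply Rmin_Rgt_l in Hz as [Hz1 Hz2].
  replace (g z - poly3 p z)%C with ((g z - f z) + (f z - poly3 p z))%C by ring.
  eapply Rle_trans; [apply Cmod_triangle |]. rewrite Rmult_plus_distr_r.
  apply Rplus_le_compat; auto.
Qed.

Lemma jet_plus (f g : C -> C) (p q : nat -> C) :
  jet f p -> jet g q -> jet (fun z => f z + g z)%C (fun n => p n + q n)%C.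
Proof.
  intros (M & d & HM & Hd & Hf) (N & e & HN & He & Hg). exists (M + N), (Rmin d e).
  split; [lra |]. split; [now apply Rmin_glb_lt |]. intros z [Hz0 Hz].
  apply Rmin_Rgt_l in Hz as [Hz1 Hz2].
  replace (f z + g z - poly3 (fun n => p n + q n) z)%C
    with ((f z - poly3 p z) + (g z - poly3 q z))%C by (unfold poly3; ring).
  eapply Rle_trans; [apply Cmod_triangle |]. rewrite Rmult_plus_distr_r.
  apply Rplus_le_compat; auto.
Qed.

Lemma jet_scal (c : C) (f : C -> C) (p : nat -> C) :
  jet f p -> jet (fun z => c * f z)%C (fun n => c * p n)%C.
Proof.
  intros (M & d & HM & Hd & Hf). exists (Cmod c * M), d.
  split; [apply Rmult_le_pos; [apply Cmod_ge_0 | exact HM] |]. split; [exact Hd |]. intros z Hz.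
  replace (c * f z - poly3 (fun n => c * p n) z)%C with (c * (f z - poly3 p z))%C
    by (unfold poly3; ring).
  rewrite Cmod_mult, Rmult_assoc. apply Rmult_le_compat_l; [apply Cmod_ge_0 | auto].
Qed.

Lemma jet_PS (a : nat -> C) (rho : R) : 0 < rho -> geom_bounded a rho -> jet (PS a) a.
Proof.
  intros Hr Ha. destruct (PS_taylor3 a rho Hr Ha) as (M & HM & H).
  exists M, (rho / 2). repeat split; try lra. intros z Hz. apply H. lra.
Qed.

Definition coefs3 (p0 p1 p2 p3 : C) (n : nat) : C :=
  match n with 0%nat => p0 | 1%nat => p1 | 2%nat => p2 | _ => p3 end.

Lemma jet_poly3_comp (f : C -> C) (r1 r2 r3 s1 s2 s3 : C) :
  jet f (coefs3 0 r1 r2 r3) ->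
  jet (fun z => poly3 (coefs3 0 s1 s2 s3) (f z))
    (coefs3 0 (s1 * r1) (s1 * r2 + s2 * r1 ^ 2) (s1 * r3 + 2 * s2 * r1 * r2 + s3 * r1 ^ 3)).
Proof.
  intros H1. assert (H2 := jet_mult _ _ _ _ H1 H1). assert (H3 := jet_mult _ _ _ _ H1 H2).
  assert (J := jet_plus _ _ _ _ (jet_plus _ _ _ _ (jet_scal s1 _ _ H1) (jet_scal s2 _ _ H2))
    (jet_scal s3 _ _ H3)).
  apply jet_ext_coef with (q := coefs3 0 (s1 * r1) (s1 * r2 + s2 * r1 ^ 2) (s1 * r3 + 2 * s2 * r1 * r2 + s3 * r1 ^ 3)) in J.
  - apply (jet_close _ _ _ 0 1) with (4 := J); try lra. intros z _.
    replace (_ - _)%C with (RtoC 0) by (unfold poly3, coefs3; ring). rewrite Cmod_0. lra.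
  - intros n Hn. do 4 (destruct n as [| n]; [unfold cauchy_prod, coefs3; ring |]). lia.
Qed.

(** Nothing is assumed of [y] but F y = G: since F y and F r agree modulo O(z^4) and |F| >= 1/2 near
    0, dividing by F preserves the order of the error. *)
Lemma jet_quotient (F G y : C -> C) (p q r : nat -> C) (d : R) :
  jet F p -> jet G q -> p 0%nat = 1%C -> 0 < d ->
  (forall z, 0 < Cmod z < d -> (F z * y z)%C = G z) ->
  (forall n, (n <= 3)%nat -> cauchy_prod p r n = q n) -> jet y r.
Proof.
  intros HF HG Hp Hd E Hr.
  assert (HFR := jet_ext_coef _ _ _ Hr (jet_mult _ _ _ _ HF (jet_poly3 r))).
  destruct HF as (M1 & d1 & HM1 & Hd1 & B1), HG as (M2 & d2 & HM2 & Hd2 & B2),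
    HFR as (M3 & d3 & HM3 & Hd3 & B3).
  set (K := Cmod (p 1%nat) + Cmod (p 2%nat) + Cmod (p 3%nat) + M1).
  assert (P1 := Cmod_ge_0 (p 1%nat)). assert (P2 := Cmod_ge_0 (p 2%nat)). assert (P3 := Cmod_ge_0 (p 3%nat)).
  assert (HK : 0 <= K) by (unfold K; lra).
  (* The last radius makes |1 - F| <= K |z| <= 1/2, which costs the factor 2 in the constant. *)
  exists (2 * (M2 + M3)), (Rmin (Rmin d (Rmin d1 d2)) (Rmin (Rmin d3 1) (/ (2 * (K + 1))))).
  split; [lra |]. split.
  { repeat apply Rmin_glb_lt; try lra. apply Rinv_0_lt_compat. lra. }
  intros z [Hz0 Hz].
  apply Rmin_Rgt_l in Hz as [Hz Hz']. apply Rmin_Rgt_l in Hz as [Hzd Hz].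
  apply Rmin_Rgt_l in Hz as [Hz1 Hz2]. apply Rmin_Rgt_l in Hz' as [Hz' Hz5].
  apply Rmin_Rgt_l in Hz' as [Hz3 Hz4].
  specialize (B1 z ltac:(lra)). specialize (B2 z ltac:(lra)). specialize (B3 z ltac:(lra)).
  specialize (E z ltac:(lra)).
  set (t := Cmod z) in *.
  assert (Ht2 : t ^ 2 <= t) by nra. assert (Ht3 : t ^ 3 <= t) by nra.
  assert (Ht4 : t ^ 4 <= t).
  { replace (t ^ 4) with (t * t ^ 3) by ring. nra. }
  assert (HF : / 2 <= Cmod (F z)).
  { assert (N : Cmod (1 - F z) <= K * t).
    { replace (1 - F z)%C with (- (F z - poly3 p z) + - (p 1%nat * z + p 2%nat * z ^ 2 + p 3%nat * z ^ 3))%C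
        by (unfold poly3; rewrite Hp; ring).
      eapply Rle_trans; [apply Cmod_triangle |]. rewrite !Cmod_opp.
      assert (N : Cmod (p 1%nat * z + p 2%nat * z ^ 2 + p 3%nat * z ^ 3)
                  <= Cmod (p 1%nat) * t + Cmod (p 2%nat) * t ^ 2 + Cmod (p 3%nat) * t ^ 3).
      { eapply Rle_trans; [apply Cmod_triangle |].
        eapply Rle_trans; [apply Rplus_le_compat_r, Cmod_triangle |].
        rewrite !Cmod_mult, !Cmod_pow. apply Rle_refl. }
      unfold K. nra. }
    assert (N2 : K * t <= / 2).
    { apply Rle_trans with ((K + 1) * / (2 * (K + 1))); [apply Rmult_le_compat; lra |].
      apply Req_le. field. lra. }
    assert (T := Cmod_triangle (1 - F z) (F z)).
    replace (1 - F z + F z)%C with (RtoC 1) in T by ring. rewrite Cmod_1 in T. lra. }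
  assert (B : Cmod (F z) * Cmod (y z - poly3 r z) <= (M2 + M3) * t ^ 4).
  { rewrite <- Cmod_mult.
    replace (F z * (y z - poly3 r z))%C with ((G z - poly3 q z) + - (F z * poly3 r z - poly3 q z))%C
      by (rewrite <- E; ring).
    eapply Rle_trans; [apply Cmod_triangle |]. rewrite Cmod_opp. lra. }
  assert (Y := Cmod_ge_0 (y z - poly3 r z)). nra.
Qed.

Lemma taylor_geom_bounded (f : C -> C) (a : nat -> C) (rho : R) :
  0 < rho < 1 -> taylor_expansion f a -> geom_bounded a rho.
Proof.
  intros Hr H.
  assert (Hu : unit_disk rho) by (unfold unit_disk; rewrite Cmod_R, Rabs_right; lra).
  destruct (proj1 (is_pseries_Cser _ _ _) (H _ Hu)) as [H1 H2].
  assert (B : forall u l, is_series u l -> exists M, forall n : nat, Rabs (u n) <= M).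
  { intros u l Hl. assert (L := ex_series_lim_0 u (ex_intro _ l Hl)).
    destruct (filterlim_bounded (V := R_NormedModule) u (ex_intro _ 0 L)) as [M HM].
    now exists M. }
  destruct (B _ _ H1) as [M1 B1], (B _ _ H2) as [M2 B2].
  exists (M1 + M2). intros n.
  replace (Cmod (a n) * rho ^ n) with (Cmod (a n * rho ^ n)).
  - eapply Rle_trans; [apply Cmod_le_Rabs |]. apply Rplus_le_compat; [apply B1 | apply B2].
  - rewrite Cmod_mult, Cmod_pow, Cmod_R, (Rabs_right rho); lra.
Qed.

(* Reversion of v = 1 - log (1 + w) / w = w/2 - w^2/3 + w^3/4 - ... *)
Definition log_reversion : nat -> C := coefs3 0 2 (8 / 3) (28 / 9).

Lemma jet_log_reversion :
  jet (fun w => poly3 log_reversion (1 - RPS log_coef w)) (coefs3 0 1 0 0).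
Proof.
  assert (H : jet (fun w => 1 - RPS log_coef w)%C (coefs3 0 (/ 2) (- / 3) (/ 4))).
  { assert (J := jet_plus _ _ _ _ (jet_poly3 (coefs3 1 0 0 0)) (jet_scal (- (1)) _ _
      (jet_PS _ 1 Rlt_0_1 (geom_bounded_1 _ log_coef_bound)))).
    apply jet_ext_coef with (q := coefs3 0 (/ 2) (- / 3) (/ 4)) in J.
    - apply (jet_close _ _ _ 0 1) with (4 := J); try lra. intros z _.
      replace (_ - _)%C with (RtoC 0) by (unfold poly3, coefs3, RPS; ring). rewrite Cmod_0. lra.
    - intros n Hn. unfold log_coef.
      do 4 (destruct n as [| n]; [apply injective_projections; simpl; field |]). lia. }
  eapply jet_ext_coef; [| apply jet_poly3_comp, H].
  intros n Hn. do 4 (destruct n as [| n]; [apply injective_projections; simpl; field |]). lia.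
Qed.

(** With L(w) = log (1 + w) / w, subordination reads f' L(w) = f / z, that is, f' y = f' - f / z for
    y = 1 - L(w). Hence r1, r2, r3 are the coefficients of [y], and the reversion of 1 - L recovers
    those of [w]. *)
Lemma jet_schwarz_coef (f w : C -> C) (a : nat -> C) :
  class_A f -> (forall z, unit_disk z -> z <> 0%C -> f z <> 0%C) -> taylor_expansion f a ->
  holomorphic_on_disk w -> w 0 = 0%C -> (forall z, unit_disk z -> Cmod (w z) < 1) ->
  (forall z, unit_disk z -> starlike_quotient f z = Psi (w z)) ->
  let r1 := a 2%nat in
  let r2 := (2 * a 3%nat - 2 * a 2%nat ^ 2)%C in
  let r3 := (3 * a 4%nat - 7 * a 2%nat * a 3%nat + 4 * a 2%nat ^ 3)%C in
  jet w (coefs3 0 (2 * r1) (2 * r2 + 8 / 3 * r1 ^ 2) (2 * r3 + 2 * (8 / 3) * r1 * r2 + 28 / 9 * r1 ^ 3)).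
Proof.
  intros (Hf & f0 & f1) Hne Ht Hw w0 Hw1 Hq r1 r2 r3.
  assert (Ha : geom_bounded a (1 / 2)) by (apply (taylor_geom_bounded f); [lra | exact Ht]).
  assert (Ha' : geom_bounded (PS_deriv a) (1 / 4)) by (apply (geom_bounded_deriv a (1 / 2)); [lra | exact Ha]).
  assert (HaS : geom_bounded (fun n => a (S n)) (1 / 2)) by (apply geom_bounded_S; [lra | exact Ha]).
  assert (Ef : forall z, Cmod z < 1 -> f z = PS a z).
  { intros z Hz. symmetry. apply PS_unique, is_pseries_Cser, Ht, Hz. }
  assert (Df : forall z, Cmod z < 1 / 2 -> C_derive f z = PS (PS_deriv a) z).
  { intros z Hz. apply Cder_C_derive. apply Cder_ext_loc with (PS a) (1 / 2); [lra | |].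
    - intros h Hh. symmetry. apply Ef. eapply Rle_lt_trans; [apply Cmod_triangle | lra].
    - now apply (Cder_PS a (1 / 2)). }
  assert (C0 : Cmod 0 < 1 / 2) by (rewrite Cmod_0; lra).
  assert (a0 : a 0%nat = 0%C) by (rewrite <- PS_0, <- Ef by lra; exact f0).
  assert (a1 : a 1%nat = 1%C).
  { rewrite Df, PS_0 in f1 by exact C0. unfold PS_deriv in f1. simpl in f1.
    rewrite <- f1. ring. }
  destruct Psi_power_series as (G & _ & _ & _ & HPsi).
  set (y := fun z => (1 - RPS log_coef (w z))%C).
  assert (Jy : jet y (coefs3 0 r1 r2 r3)).
  { apply (jet_quotient (PS (PS_deriv a)) (fun z => PS (PS_deriv a) z + - (1) * PS (fun n => a (S n)) z)%C
      y (PS_deriv a) (fun n => PS_deriv a n + - (1) * a (S n))%C _ (1 / 4)).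
    - apply jet_PS with (1 / 4); [lra | exact Ha'].
    - apply jet_plus; [apply jet_PS with (1 / 4); [lra | exact Ha'] |].
      apply jet_scal, (jet_PS (fun n => a (S n)) (1 / 2)); [lra | exact HaS].
    - unfold PS_deriv. rewrite a1. simpl. ring.
    - lra.
    - intros z Hz. assert (Hd : unit_disk z) by (unfold unit_disk; lra).
      assert (Hz0 : z <> 0%C) by (intros ->; rewrite Cmod_0 in Hz; lra).
      destruct (HPsi (w z) (Hw1 z Hd)) as [_ HL]. rewrite <- Hq in HL by exact Hd.
      unfold starlike_quotient in HL. destruct (Ceq_dec z 0) as [h | _]; [contradiction |].
      rewrite Df in HL by lra.
      assert (Hfz := Hne z Hd Hz0).
      assert (Ez : f z = (z * PS (fun n => a (S n)) z)%C).
      { rewrite Ef by lra. rewrite (PS_shift a (1 / 2)) by (try exact Ha; lra). rewrite a0. ring. }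
      unfold y. set (L := RPS log_coef (w z)) in *. set (D := PS (PS_deriv a) z) in *.
      assert (X : (z * D * L)%C = f z).
      { transitivity (z * D / f z * L * f z)%C; [field; exact Hfz | rewrite HL; ring]. }
      assert (X2 : (D * L)%C = PS (fun n => a (S n)) z).
      { transitivity (z * D * L / z)%C; [field; exact Hz0 |]. rewrite X, Ez. field. exact Hz0. }
      rewrite <- X2. ring.
    - intros n Hn. unfold r1, r2, r3.
      do 4 (destruct n as [| n]; [unfold cauchy_prod, coefs3, PS_deriv; rewrite ?a1; simpl; rewrite ?RtoC_plus; ring |]). lia. }
  assert (JR : jet (fun z => poly3 log_reversion (y z))
    (coefs3 0 (2 * r1) (2 * r2 + 8 / 3 * r1 ^ 2) (2 * r3 + 2 * (8 / 3) * r1 * r2 + 28 / 9 * r1 ^ 3)))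
    by now apply jet_poly3_comp.
  (* The first-order bound |w| <= K |z| turns the O(w^4) error of the reversion into O(z^4). *)
  destruct (Cder_lipschitz w 0 _ (ex_derive_Cder w 0 (Hw 0%C ltac:(unfold unit_disk; lra))))
    as (d1 & Hd1 & Lip).
  set (K := Cmod (C_derive w 0) + 1) in *.
  assert (HK : 0 < K) by (unfold K; pose proof (Cmod_ge_0 (C_derive w 0)); lra).
  destruct jet_log_reversion as (M & d2 & HM & Hd2 & HB).
  apply (jet_close (fun z => poly3 log_reversion (y z)) w _ (M * K ^ 4) (Rmin d1 (d2 / K))); [| | | exact JR].
  - apply Rmult_le_pos; [exact HM | apply pow_le; lra].
  - apply Rmin_glb_lt; [exact Hd1 | now apply Rdiv_lt_0_compat].
  - intros z [Hz0 Hz]. apply Rmin_Rgt_l in Hz as [Hz1 Hz2].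
    specialize (Lip z Hz1). rewrite w0 in Lip.
    replace (0 + z)%C with z in Lip by ring. replace (w z - 0)%C with (w z) in Lip by ring.
    assert (HKz : K * Cmod z < d2).
    { apply (Rmult_lt_compat_l K) in Hz2; [| exact HK].
      replace (K * (d2 / K)) with d2 in Hz2 by (field; lra). exact Hz2. }
    assert (Hwz := Cmod_ge_0 (w z)).
    apply Rle_trans with (M * Cmod (w z) ^ 4).
    (* A jet says nothing at 0, so zeros of [w] are treated apart; there y = 0 exactly. *)
    + destruct (Rle_lt_or_eq_dec _ _ Hwz) as [Hp | Hp].
      * specialize (HB (w z) ltac:(lra)). rewrite <- Cmod_opp.
        replace (poly3 (coefs3 0 1 0 0) (w z)) with (w z) in HB by (unfold poly3, coefs3; ring).
        replace (- (w z - poly3 log_reversion (y z)))%C with (poly3 log_reversion (y z) - w z)%C by ring.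
        exact HB.
      * symmetry in Hp. apply Cmod_eq_0 in Hp. unfold y. rewrite Hp. unfold RPS. rewrite PS_0.
        replace (RtoC (log_coef 0)) with (RtoC 1) by (unfold log_coef; simpl; f_equal; field).
        replace (0 - _)%C with (RtoC 0) by (unfold poly3, log_reversion, coefs3; ring).
        rewrite Cmod_0. lra.
    + rewrite Rmult_assoc, <- Rpow_mult_distr. apply Rmult_le_compat_l; [exact HM |].
      apply pow_incr. lra.
Qed.

Lemma hankel21_bound (f : C -> C) (a : nat -> C) :
  class_SG f -> taylor_expansion f a -> Cmod (hankel21 a) <= 1 / 64.
Proof.
  intros (Hf & Hne & w & Hw & w0 & Hw1 & Hq) Ht.
  assert (J := jet_schwarz_coef f w a Hf Hne Ht Hw w0 Hw1 Hq). cbv zeta in J.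
  match type of J with jet _ (coefs3 _ ?u ?v ?t) => set (c1 := u) in J; set (c2 := v) in J; set (c3 := t) in J end.
  destruct (schur_parameters c1 c2 c3) as (Hc1 & x & y & Hx & Hy & E2 & E3).
  { intros q0 q1 q2.
    (* As c0 = 0, the product starts in degree 1, and the contraction becomes that of the 3 by 3
       Toeplitz matrix of w / z. *)
    assert (T := toeplitz_contraction w (coefs3 0 c1 c2 c3) (coefs3 q0 q1 q2 0)
      (fun z Hz => ex_intro _ _ (ex_derive_Cder w z (Hw z Hz)))
      (fun z Hz => Rlt_le _ _ (Hw1 z Hz)) J).
    unfold norm4, cauchy_prod, coefs3 in T.
    rewrite !Cmult_0_l, !Cplus_0_l, Cmod_0 in T.
    replace (c1 * q1 + c2 * q0)%C with (0 + (c1 * q1 + c2 * q0))%C by ring.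
    rewrite !Cplus_0_l. lra. }
  assert (B := schur_functional_bound c1 c2 c3 x y Hc1 Hx Hy E2 E3).
  replace (48 * c1 * c3 - 4 * c1 ^ 2 * c2 - 36 * c2 ^ 2 + 3 * c1 ^ 4)%C with (2304 * hankel21 a)%C in B.
  - rewrite Cmod_mult, Cmod_R, Rabs_right in B by lra. lra.
  - unfold hankel21, gamma1, gamma2, gamma3, c1, c2, c3. field.
Qed.

(** * The extremal function *)

(** Coefficients of the series in z^2. It is polymorphic so as to act both on coefficients and on
    complex terms. *)
Definition spread2 {T : Type} (zero : T) (x : nat -> T) (n : nat) : T :=
  if Nat.even n then x (Nat.div2 n) else zero.

Lemma spread2_double {T : Type} (zero : T) (x : nat -> T) (m : nat) :
  spread2 zero x (2 * m) = x m /\ spread2 zero x (S (2 * m)) = zero.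
Proof.
  unfold spread2. rewrite Nat.even_succ, Nat.odd_mul, Nat.even_mul, Nat.div2_double. now split.
Qed.

(** Every partial sum merely occurs twice in a row. *)
Lemma is_series_spread2 (x : nat -> R) (l : R) : is_series x l -> is_series (spread2 0 x) l.
Proof.
  intros H.
  assert (E : forall m, sum_n (spread2 0 x) (2 * m) = sum_n x m /\
                        sum_n (spread2 0 x) (S (2 * m)) = sum_n x m).
  { induction m as [| m [_ IH]].
    - change (2 * 0)%nat with 0%nat. rewrite sum_Sn, !sum_O. unfold spread2; simpl.
      split; [reflexivity | apply Rplus_0_r].
    - destruct (spread2_double 0 x (S m)) as [E1 E2].
      assert (E3 : sum_n (spread2 0 x) (2 * S m) = sum_n x (S m)).
      { rewrite sum_Sn. rewrite <- E1, <- IH.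
        replace (2 * S m)%nat with (S (S (2 * m))) by lia. now rewrite sum_Sn. }
      split; [exact E3 |]. rewrite sum_Sn, E3, E2. apply Rplus_0_r. }
  intros P HP. destruct (H P HP) as [N HN]. exists (2 * N)%nat. intros n Hn.
  destruct (Nat.Even_or_Odd n) as [[m ->] | [m ->]].
  - exact (eq_ind_r P (HN m ltac:(lia)) (proj1 (E m))).
  - rewrite Nat.add_1_r. exact (eq_ind_r P (HN m ltac:(lia)) (proj2 (E m))).
Qed.

Lemma RPS_square (a : nat -> R) (z : C) : (forall n, Rabs (a n) <= 1) -> Cmod z < 1 ->
  RPS a (z * z) = RPS (spread2 0 a) z.
Proof.
  intros Ha Hz. symmetry. apply PS_unique.
  assert (Hz2 : Cmod (z * z) < 1) by (rewrite Cmod_mult; pose proof (Cmod_ge_0 z); nra).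
  destruct (RPS_correct a (z * z) Ha Hz2) as [H1 H2].
  assert (E : forall n, (spread2 0 a n * z ^ n)%C = spread2 (RtoC 0) (fun k => a k * (z * z) ^ k)%C n).
  { intros n. destruct (Nat.Even_or_Odd n) as [[m ->] | [m ->]]; rewrite ?Nat.add_1_r.
    - rewrite (proj1 (spread2_double 0 a m)), (proj1 (spread2_double _ _ m)), Cpow_mult_r.
      do 2 f_equal. simpl. ring.
    - rewrite (proj2 (spread2_double 0 a m)), (proj2 (spread2_double _ _ m)). ring. }
  apply is_series_spread2 in H1, H2.
  split; [eapply is_series_ext; [| exact H1] | eapply is_series_ext; [| exact H2]];
    intros n; cbv beta; rewrite E; unfold spread2; now destruct Nat.even.
Qed.

(** The coefficient recursion of u' = s u. The convolution has n + 1 terms bounded by 1, and the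
    division by n + 1 restores the bound, so that [u] converges on the whole disk. *)
Lemma linear_ode_coef (s : nat -> R) : (forall n, Rabs (s n) <= 1) ->
  exists u : nat -> R, u 0%nat = 1 /\ (forall n, Rabs (u n) <= 1) /\
    forall n, INR (S n) * u (S n) = conv s u n.
Proof.
  intros Hs.
  destruct (course_of_values_rec (fun n a => match n with
    | O => 1 | S m => conv s a m / INR (S m) end)) as [u Hu].
  { intros [| n] a a' H; [reflexivity |]. f_equal. apply sum_eq. intros k Hk. rewrite H by lia. reflexivity. }
  assert (P : forall n, 0 < INR (S n)) by (intros n; apply lt_0_INR; lia).
  exists u. split; [apply Hu |]. split.
  - intros n. induction n as [n IH] using (well_founded_induction Wf_nat.lt_wf).
    rewrite Hu. destruct n as [| n]; [rewrite Rabs_R1; lra |].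
    specialize (P n). unfold Rdiv. rewrite Rabs_mult, (Rabs_right (/ INR (S n))).
    2: { apply Rle_ge, Rlt_le, Rinv_0_lt_compat, P. }
    apply Rle_div_l; [exact P |]. rewrite Rmult_1_l.
    eapply Rle_trans; [apply Rsum_abs |].
    rewrite <- (Rmult_1_l (INR (S n))), <- sum_cte. apply sum_Rle. intros k Hk.
    rewrite Rabs_mult, <- (Rmult_1_l 1).
    apply Rmult_le_compat; auto using Rabs_pos. apply IH. lia.
  - intros n. rewrite (Hu (S n)). field. apply Rgt_not_eq, P.
Qed.

Lemma Cder_RPS_ode (s u : nat -> R) (z : C) :
  (forall n, Rabs (s n) <= 1) -> (forall n, Rabs (u n) <= 1) ->
  (forall n, INR (S n) * u (S n) = conv s u n) -> Cmod z < 1 ->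
  Cder (RPS u) z (RPS s z * RPS u z).
Proof.
  intros Hs Hu E Hz.
  replace (RPS s z * RPS u z)%C with (PS (PS_deriv (fun n => RtoC (u n))) z).
  - apply (Cder_PS _ 1); [now apply geom_bounded_1 | exact Hz].
  - rewrite RPS_mult by assumption. unfold RPS. f_equal.
    apply functional_extensionality. intros n.
    unfold PS_deriv. now rewrite <- RtoC_mult, E.
Qed.

Lemma Cder_zero_const (F : C -> C) (z : C) :
  (forall z, Cmod z < 1 -> Cder F z 0) -> Cmod z < 1 -> F z = F 0%C.
Proof.
  intros H Hz.
  assert (D : forall t : R, 0 <= t <= 1 -> is_derive (fun t : R => fst (F (0 + t * z)%C)) t 0 /\
                              is_derive (fun t : R => snd (F (0 + t * z)%C)) t 0).
  { intros t Ht.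
    assert (L : Cder F (0 + t * z)%C 0).
    { apply H. rewrite Cplus_0_l, Cmod_mult, Cmod_R, Rabs_right by lra. pose proof (Cmod_ge_0 z). nra. }
    apply Cder_line in L. now rewrite Cmult_0_r in L. }
  assert (E1 := eq_is_derive (V := R_NormedModule) _ 0 1 (fun t Ht => proj1 (D t Ht)) Rlt_0_1).
  assert (E2 := eq_is_derive (V := R_NormedModule) _ 0 1 (fun t Ht => proj2 (D t Ht)) Rlt_0_1).
  cbv beta in E1, E2.
  replace (0 + 1 * z)%C with z in E1, E2 by ring. replace (0 + 0 * z)%C with (RtoC 0) in E1, E2 by ring.
  symmetry. now apply injective_projections.
Qed.

(* The solution v of v' = - s v is an inverse of u, as (u v)' = 0. *)
Lemma linear_ode_nonzero (s u : nat -> R) (z : C) :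
  (forall n, Rabs (s n) <= 1) -> u 0%nat = 1 -> (forall n, Rabs (u n) <= 1) ->
  (forall n, INR (S n) * u (S n) = conv s u n) -> Cmod z < 1 -> RPS u z <> 0%C.
Proof.
  intros Hs u0 Hu E Hz.
  assert (Hs' : forall n, Rabs (- s n) <= 1) by (intros n; rewrite Rabs_Ropp; apply Hs).
  destruct (linear_ode_coef (fun n => - s n) Hs') as (v & v0 & Hv & Ev).
  assert (X : (RPS u z * RPS v z)%C = (RPS u 0 * RPS v 0)%C).
  { apply (Cder_zero_const (fun z => RPS u z * RPS v z)%C); [| exact Hz].
    intros x Hx.
    replace (RtoC 0) with (RPS s x * RPS u x * RPS v x + RPS u x * (RPS (fun n => (- s n)%R) x * RPS v x))%C.
    - apply Cder_mult; now apply Cder_RPS_ode.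
    - rewrite RPS_opp by assumption. ring. }
  intros Z. rewrite Z in X. unfold RPS in X. rewrite !PS_0, u0, v0 in X.
  rewrite Cmult_0_l, Cmult_1_l in X. apply RtoC_inj in X. lra.
Qed.

(** Writing Psi(z^2) = 1 + z s(z) removes the singularity of the equation at 0: it becomes u' = s u,
    and f = z u has z f' / f = 1 + z s. *)
Lemma hankel21_sharp : exists (f : C -> C) (a : nat -> C),
  class_SG f /\ taylor_expansion f a /\ Cmod (hankel21 a) = 1 / 64.
Proof.
  destruct Psi_power_series as (G & HG & G0 & G1 & HPsi).
  set (q := spread2 0 G).
  assert (Hq : forall n, Rabs (q n) <= 1).
  { intros n. unfold q, spread2. destruct Nat.even; [apply HG | rewrite Rabs_R0; lra]. }
  set (s := fun n => q (S n)).
  assert (Hs : forall n, Rabs (s n) <= 1) by (intros n; apply Hq).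
  destruct (linear_ode_coef s Hs) as (u & u0 & Hu & Eu).
  set (f := fun z : C => (z * RPS u z)%C).
  set (a := fun n => match n with O => RtoC 0 | S m => RtoC (u m) end).
  assert (Df : forall z, Cmod z < 1 -> Cder f z (1 * RPS u z + z * (RPS s z * RPS u z))).
  { intros z Hz. apply Cder_mult; [apply Cder_id | now apply Cder_RPS_ode]. }
  assert (Nu : forall z, Cmod z < 1 -> RPS u z <> 0%C).
  { intros z Hz. now apply (linear_ode_nonzero s). }
  assert (Eq : forall z, Cmod z < 1 -> Psi (z * z) = (1 + z * RPS s z)%C).
  { intros z Hz. assert (Hz2 : Cmod (z * z) < 1) by (rewrite Cmod_mult; pose proof (Cmod_ge_0 z); nra).
    rewrite (proj1 (HPsi _ Hz2)), RPS_square by assumption. fold q. unfold RPS at 1.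
    rewrite (PS_shift _ 1 z); [| now apply geom_bounded_1 | exact Hz].
    change (q 0%nat) with (G 0%nat). now rewrite G0. }
  exists f, a. split; [split; [| split] | split].
  - split; [| split].
    + intros z Hz. eexists. apply Cder_is_derive, Df, Hz.
    + unfold f. ring.
    + rewrite (Cder_C_derive _ _ _ (Df 0%C ltac:(rewrite Cmod_0; lra))).
      unfold RPS. rewrite !PS_0, u0. ring.
  - intros z Hz Hz0. unfold f. apply Cmult_neq_0; auto.
  - exists (fun z => z * z)%C. split; [| split; [ring | split]].
    + intros z Hz. eexists. apply Cder_is_derive. apply Cder_mult; apply Cder_id.
    + intros z Hz. unfold unit_disk in Hz. rewrite Cmod_mult. pose proof (Cmod_ge_0 z). nra.
    + intros z Hz. rewrite Eq by exact Hz. unfold starlike_quotient.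
      destruct (Ceq_dec z 0) as [-> | Hz0]; [ring |].
      rewrite (Cder_C_derive _ _ _ (Df z Hz)). unfold f. field. split; [now apply Nu | exact Hz0].
  - intros z Hz. apply is_pseries_Cser.
    replace (f z) with (a 0%nat * z ^ 0 + z * RPS u z)%C by (unfold f, a; simpl; ring).
    apply (is_Cser_shift (fun n => a n * z ^ n)%C).
    eapply is_Cser_ext; [| apply is_Cser_scal, RPS_correct; [exact Hu | exact Hz]].
    intros n. simpl. ring.
  (* Here a2 = a4 = 0 and 2 a3 = G 1 = 1/2, so only gamma2 = 1/8 survives and the determinant is
     -1/64. *)
  - assert (E0 := Eu 0%nat). assert (E1 := Eu 1%nat). assert (E2 := Eu 2%nat).
    unfold conv, s, q, spread2 in E0, E1, E2. simpl in E0, E1, E2. rewrite u0, ?G1 in E0, E1, E2.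
    assert (u1 : u 1%nat = 0) by lra.
    assert (u2 : u 2%nat = 1 / 4) by lra.
    assert (u3 : u 3%nat = 0) by (rewrite u1 in E2; lra).
    unfold hankel21, gamma1, gamma2, gamma3, a. rewrite u1, u2, u3.
    replace (_ - _)%C with (RtoC (- (1 / 64))) by (apply injective_projections; simpl; field).
    rewrite Cmod_R, Rabs_Ropp, Rabs_right; lra.
Qed.

Theorem theorem2p1 :
  (forall (f : C -> C) (a : nat -> C),
     class_SG f -> taylor_expansion f a -> (Cmod (hankel21 a) <= 1 / 64)%R) /\
  (exists (f : C -> C) (a : nat -> C),
     class_SG f /\ taylor_expansion f a /\ (Cmod (hankel21 a) = 1 / 64)%R).
Proof. exact (conj hankel21_bound hankel21_sharp). Qed.
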